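(* Let $d\in\mathbb{R}$, let $f$ be a majority-type update function with parameters $m,\beta,\gamma$, and let the initial number of vertices with opinion $X$ be $X_0=n/2+d\sqrt{n}+o(\sqrt{n})$. Then $$R_n(X_0)=\tfrac12\log_\gamma n+\log_m\ln n+O_{\mathbb{P}}(1).$$
   Context: Majority-type update function: a function $f:[0,1]\to[0,1]$ such that (i) $f$ is $(m+1)$-times continuously differentiable for some integer $m\ge 2$; (ii) $f$ is convex on $[0,1/2]$; (iii) $1-f(1-x)=f(x)$ for all $x\in[0,1]$; (iv) there exist $\gamma>1$ and $\beta>0$ such that, as $x\to0$, $f(x)=\beta x^m+O(x^{m+1})$ and $f(1/2+x)=1/2+\gamma x+O(x^2)$. The numbers $m,\beta,\gamma$ are called its parameters. Process: there are $n$ vertices, each holding opinion $X$ or $Y$. $X_t$ is the number of vertices with opinion $X$ after round $t$. The process $(X_t)_{t\in\mathbb{N}_0}$ (depending on $n$) is the Markov chain with deterministic initial value $X_0\in[0,n]$ (not required to be an integer) and, conditionally on $X_t$, $X_{t+1}\stackrel{d}{=}\mathrm{Bin}(n,f(X_t/n))$. Put $Y_t=n-X_t$. The runtime is $R_n(X_0)=\inf\{t\in\mathbb{N}_0: X_t=n\text{ or }Y_t=n\}$. For random variables $W_n$, $W_n=O_{\mathbb{P}}(1)$ means: for every $\varepsilon>0$ there exist $C_\varepsilon,n_\varepsilon$ such that $\mathbb{P}(|W_n|\ge C_\varepsilon)\le\varepsilon$ for all $n\ge n_\varepsilon$. *)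

(* Defs.v *)
From HB Require Import structures.
From mathcomp Require Import all_boot all_order all_algebra.
From mathcomp Require Import all_classical all_reals all_analysis.

Set Implicit Arguments.
Unset Strict Implicit.
Unset Printing Implicit Defensive.

Import Order.TTheory GRing.Theory Num.Theory.
Import numFieldNormedType.Exports.

Local Open Scope classical_set_scope.
Local Open Scope ring_scope.

(* g' is the derivative of g on A, relative to A: one-sided at the endpoints of
   an interval, and insensitive to the values of g outside A. *)
Definition derivative_on (R : realType) (A : set R) (g g' : R -> R) : Prop :=
  forall x, A x -> (g y - g x) / (y - x) @[y --> within A x^'] --> g' x.

Definition continuously_differentiable_on (R : realType) (A : set R) (k : nat)
    (f : R -> R) : Prop :=
  exists g : nat -> R -> R,
    [/\ g 0%N = f,
        forall i, (i < k)%N -> derivative_on A (g i) (g i.+1) &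
        {within A, continuous (g k)}].

(* An update function [0,1] -> [0,1] is a function on R of which only the
   restriction to [0,1] matters; hence "x -> 0" in the expansion of f at 0
   ranges over [0,1]. *)
Record majority_type_update (R : realType) (m : nat) (beta gamma : R)
    (f : R -> R) : Prop := MajorityTypeUpdate {
  majority_range : forall x : R, x \in `[0, 1] -> f x \in `[0, 1];
  majority_m_ge2 : (2 <= m)%N;
  majority_gamma_gt1 : 1 < gamma;
  majority_beta_gt0 : 0 < beta;
  majority_smooth :
    continuously_differentiable_on `[0, 1]%classic m.+1 f;
  majority_convex :
    convex_function (`[(0 : R), 2^-1]%classic : set R^o) (f : R^o -> R^o);
  majority_symm : forall x : R, x \in `[0, 1] -> 1 - f (1 - x) = f x;
  majority_at0 :
    (fun x => f x - beta * x ^+ m)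
      =O_ (within `[0, 1]%classic (nbhs (0 : R))) (fun x => x ^+ m.+1);
  majority_at_half :
    (fun x => f (2^-1 + x) - (2^-1 + gamma * x))
      =O_ (nbhs (0 : R)) (fun x => x ^+ 2) }.

(* X is a Markov chain started at x0 with transition law Bin(n, f (X_t / n)).
   The states are discrete, so the conditional law of X_{t+1} given
   X_0, ..., X_t is expressed on the atoms {X_0 = x_0, ..., X_t = x_t}.
   For t >= 1 it forces X_t to be a.s. a natural number at most n. *)
Definition opinion_process (R : realType) (d : measure_display)
    (T : measurableType d) (P : probability T R) (n : nat) (f : R -> R) (x0 : R)
    (X : nat -> {RV P >-> R}) : Prop :=
  (forall w, X 0%N w = x0) /\
  forall (t : nat) (x : nat -> R) (k : nat),
    let past := [set w | forall i, (i <= t)%N -> X i w = x i] in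
    P (past `&` [set w | X t.+1 w = k%:R]) =
      (P past * (binomial_pmf n (f (x t / n%:R)) k)%:E)%E.

(* inf of the empty set is +oo: the runtime is +oo if consensus never occurs. *)
Definition runtime (R : realType) (T : Type) (n : nat) (X : nat -> T -> R)
    (w : T) : \bar R :=
  ereal_inf [set (t%:R)%:E | t in
    [set t : nat | X t w = n%:R \/ n%:R - X t w = n%:R]].

(* W_n = O_P(1), each W_n living on its own probability space. *)
Definition bounded_in_probability (R : realType) (d : nat -> measure_display)
    (T : forall n, measurableType (d n)) (P : forall n, probability (T n) R)
    (W : forall n, T n -> \bar R) : Prop :=
  forall eps : R, 0 < eps ->
    exists (C : R) (N : nat), forall n, (N <= n)%N ->
      (P n [set w | C%:E <= `|W n w|] <= eps%:E)%E.

Definition logb (R : realType) (b x : R) : R := ln x / ln b.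

(* Main.v *)
Require Import Defs.
From HB Require Import structures.
From mathcomp Require Import all_boot all_order all_algebra.
From mathcomp Require Import all_classical all_reals all_analysis.
From mathcomp Require Import zify ring lra.

Set Implicit Arguments.
Unset Strict Implicit.
Unset Printing Implicit Defensive.

Import Order.TTheory GRing.Theory Num.Theory.
Import numFieldNormedType.Exports.

Local Open Scope classical_set_scope.
Local Open Scope ring_scope.

(** The chain [X_t / n] is studied through its transition operator [step], which
    maps a function [g] to [y |-> E (g (Bin (n, f y) / n))].  As consensus is
    absorbing, the probability of no consensus up to round [t] is exactly the
    [t]-th iterate of [step] on the indicator [undecided] of the non-consensus
    states ([probability_undecided]), so that the theorem reduces to upper and
    lower bounds on these iterates.  Both come from [iter_step_chain]: one
    follows the deterministic recursion [y |-> f y] with some slack, and adds up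
    the probabilities that a single binomial step leaves the slack.  By symmetry
    it is enough to look at the fraction [minority y] of the rarer opinion.

    Upper bound, from any initial state ([consensus_upper_bound]).  While the
    imbalance is of order [sqrt n], each step pushes it away from 0 by a constant
    times [sqrt n] with a probability bounded below
    ([step_minority_fluctuation]), so a bounded number of steps makes it
    larger than [2 K sqrt n] with high probability ([iter_step_climb]).  From
    there it grows by the factor [gamma] per step, the relative fluctuations being
    summable and small when [K] is large ([imbalance_grows]): it reaches a
    fraction of [n] after [log_gamma (sqrt n) + O(1)] steps.  Boundedly many
    further steps make the minority a small fraction ([minority_shrinks]),
    and then [f y <= C y^m] makes it decrease doubly exponentially, below
    [1 / n] and hence to 0, in [log_m (ln n) + O(1)] steps ([endgame]).

    Lower bound ([consensus_lower_bound]).  By convexity [gamma] is the largest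
    slope of [f], so an imbalance of order [sqrt n] needs
    [log_gamma (sqrt n) - O(1)] steps to become a quarter of [n]
    ([imbalance_bounded]); after that [f y >= c y^m] keeps the minority above
    a doubly exponential sequence, which stays above [n^(-1/4)] for
    [log_m (ln n) - O(1)] steps ([minority_survives]). *)

(** * Binomial expectations and concentration *)

Definition bin_mean (R : realType) (n : nat) (p : R) (g : nat -> R) : R :=
  \sum_(k < n.+1) binomial_pmf n p k * g k.

Lemma eq_bin_mean (R : realType) n (p : R) g1 g2 :
  g1 =1 g2 -> bin_mean n p g1 = bin_mean n p g2.
Proof. by move=> e; apply: eq_bigr => k _; rewrite e. Qed.

Lemma eq_in_bin_mean (R : realType) n (p : R) g1 g2 :
  (forall k, (k <= n)%N -> g1 k = g2 k) -> bin_mean n p g1 = bin_mean n p g2.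
Proof.
by move=> e; apply: eq_bigr => k _; rewrite e// -ltnS.
Qed.

Lemma bin_mean_le (R : realType) n (p : R) g1 g2 : 0 <= p <= 1 ->
  (forall k, (k <= n)%N -> g1 k <= g2 k) -> bin_mean n p g1 <= bin_mean n p g2.
Proof.
move=> p01 le12; apply: ler_sum => k _; rewrite ler_wpM2l ?binomial_pmf_ge0//.
by apply: le12; rewrite -ltnS.
Qed.

Lemma bin_meanD (R : realType) n (p : R) g1 g2 :
  bin_mean n p (fun k => g1 k + g2 k) = bin_mean n p g1 + bin_mean n p g2.
Proof. by rewrite -big_split; apply: eq_bigr => k _; rewrite mulrDr. Qed.

Lemma bin_meanZ (R : realType) n (p : R) c g :
  bin_mean n p (fun k => c * g k) = c * bin_mean n p g.
Proof. by rewrite [RHS]mulr_sumr; apply: eq_bigr => k _; rewrite mulrCA. Qed.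

Lemma bin_meanC (R : realType) n (p c : R) : bin_mean n p (fun=> c) = c.
Proof.
rewrite /bin_mean -mulr_suml.
suff -> : \sum_(k < n.+1) binomial_pmf n p k = 1 by rewrite mul1r.
rewrite -[1](expr1n _ n) -[in RHS](subrK p 1) exprDn.
by apply: eq_bigr => k _; rewrite /binomial_pmf /unstable.onem mulrC.
Qed.

(** A trial added to the previous ones: this is what lets moments be computed
    by induction on the number of trials. *)
Lemma bin_meanS (R : realType) n (p : R) g :
  bin_mean n.+1 p g =
  (1 - p) * bin_mean n p g + p * bin_mean n p (fun k => g k.+1).
Proof.
have pmf0 k : binomial_pmf k p 0 = (1 - p) ^+ k.
  by rewrite /binomial_pmf /unstable.onem expr0 mul1r subn0 bin0.
have pmfS k : (k < n.+1)%N -> binomial_pmf n.+1 p k.+1 =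
    (1 - p) * binomial_pmf n p k.+1 + p * binomial_pmf n p k.
  rewrite ltnS leq_eqVlt /binomial_pmf /unstable.onem => /predU1P[->|kn].
    by rewrite !binn bin_small// !subnn !expr0 mulr0n mulr0 exprS; ring.
  rewrite binS mulrnDr subSS; congr (_ + _); last by rewrite exprS mulrnAr mulrA.
  by rewrite mulrnAr mulrCA -exprS subnSK.
rewrite /bin_mean big_ord_recl /= pmf0.
under eq_bigr => i _ do rewrite /bump leq0n add1n pmfS// mulrDl.
rewrite big_split/= addrA; congr (_ + _); last first.
  by rewrite mulr_sumr; apply: eq_bigr => i _; rewrite mulrA.
rewrite [in RHS]big_ord_recl/= pmf0 [in LHS]big_ord_recr/=.
rewrite {2}/binomial_pmf bin_small// mulr0n mulr0 mul0r addr0 mulrDr exprS mulrA.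
by congr (_ + _); rewrite mulr_sumr; apply: eq_bigr => i _; rewrite mulrA.
Qed.

(** Successes and failures play symmetric parts. *)
Lemma bin_mean_refl (R : realType) n (p : R) g :
  bin_mean n (1 - p) g = bin_mean n p (fun k => g (n - k)%N).
Proof.
rewrite /bin_mean (reindex_inj rev_ord_inj)/=; apply: eq_bigr => -[k kn] _ /=.
rewrite subSS; congr (_ * _); rewrite /binomial_pmf /unstable.onem subKn// bin_sub//.
by rewrite mulrC opprB addrCA subrr addr0.
Qed.

(** The form in which moments of order up to 4 are expanded below. *)
Lemma bin_mean_quartic (R : realType) n (p : R) (D : nat -> R) c0 c1 c2 c3 c4 :
  bin_mean n p (fun k => c0 + c1 * D k + c2 * D k ^+ 2 + c3 * D k ^+ 3
                     + c4 * D k ^+ 4) =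
  c0 + c1 * bin_mean n p D + c2 * bin_mean n p (fun k => D k ^+ 2)
  + c3 * bin_mean n p (fun k => D k ^+ 3) + c4 * bin_mean n p (fun k => D k ^+ 4).
Proof. by rewrite !bin_meanD !bin_meanZ bin_meanC. Qed.

Section moments.
Context (R : realType) (p : R).

Definition dev (n k : nat) : R := k%:R - n%:R * p.

Let devS0 n k : dev n.+1 k = dev n k - p.
Proof. by rewrite /dev -natr1; ring. Qed.

Let devS1 n k : dev n.+1 k.+1 = dev n k + (1 - p).
Proof. by rewrite /dev -!natr1; ring. Qed.

Lemma bin_mean_dev n : bin_mean n p (dev n) = 0.
Proof.
elim: n => [|n IH].
  by rewrite /bin_mean big_ord1 /dev mul0r subr0 mulr0.
rewrite bin_meanS (eq_bin_mean n p (devS0 n)) (eq_bin_mean n p (devS1 n)).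
by rewrite 2!bin_meanD IH !bin_meanC; ring.
Qed.

Lemma bin_mean_dev2 n : bin_mean n p (fun k => dev n k ^+ 2) = n%:R * (p * (1 - p)).
Proof.
elim: n => [|n IH].
  by rewrite /bin_mean big_ord1 /dev mul0r subr0 expr0n mulr0 mul0r.
have e0 k : dev n.+1 k ^+ 2 = p ^+ 2 + (- (2 * p)) * dev n k
    + 1 * dev n k ^+ 2 + 0 * dev n k ^+ 3 + 0 * dev n k ^+ 4.
  by rewrite devS0; ring.
have e1 k : dev n.+1 k.+1 ^+ 2 = (1 - p) ^+ 2 + (2 * (1 - p)) * dev n k
    + 1 * dev n k ^+ 2 + 0 * dev n k ^+ 3 + 0 * dev n k ^+ 4.
  by rewrite devS1; ring.
rewrite bin_meanS (eq_bin_mean n p e0) (eq_bin_mean n p e1) !bin_mean_quartic.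
rewrite bin_mean_dev IH.
by rewrite -natr1; ring.
Qed.

Lemma bin_mean_dev4 n : bin_mean n p (fun k => dev n k ^+ 4) =
  n%:R * (p * (1 - p)) * (1 + 3 * (n%:R - 2) * (p * (1 - p))).
Proof.
elim: n => [|n IH].
  by rewrite /bin_mean big_ord1 /dev mul0r subr0 expr0n mulr0 !mul0r.
have e0 k : dev n.+1 k ^+ 4 = p ^+ 4 + (- (4 * p ^+ 3)) * dev n k
    + (6 * p ^+ 2) * dev n k ^+ 2 + (- (4 * p)) * dev n k ^+ 3
    + 1 * dev n k ^+ 4.
  by rewrite devS0; ring.
have e1 k : dev n.+1 k.+1 ^+ 4 = (1 - p) ^+ 4 + (4 * (1 - p) ^+ 3) * dev n k
    + (6 * (1 - p) ^+ 2) * dev n k ^+ 2 + (4 * (1 - p)) * dev n k ^+ 3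
    + 1 * dev n k ^+ 4.
  by rewrite devS1; ring.
rewrite bin_meanS (eq_bin_mean n p e0) (eq_bin_mean n p e1) !bin_mean_quartic.
by rewrite bin_mean_dev bin_mean_dev2 IH -natr1; ring.
Qed.

End moments.

Lemma variance_le4 (R : realType) (p : R) : p * (1 - p) <= 4^-1.
Proof.
have -> : p * (1 - p) = 4^-1 - (p - 2^-1) ^+ 2 by field.
by have := sqr_ge0 (p - 2^-1); lra.
Qed.

Lemma bin_mean_chebyshev (R : realType) n (p s : R) (S : nat -> bool) :
  (0 < n)%N -> 0 <= p <= 1 -> 0 < s ->
  (forall k, (k <= n)%N -> S k -> s <= `|k%:R / n%:R - p|) ->
  bin_mean n p (fun k => (S k)%:R) <= p * (1 - p) / (n%:R * s ^+ 2).
Proof.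
move=> n0 p01 s0 Ss.
have n0R : 0 < n%:R :> R by rewrite ltr0n.
pose c : R := (n%:R * s) ^- 2.
have cE : bin_mean n p (fun k => c * dev p n k ^+ 2) = p * (1 - p) / (n%:R * s ^+ 2).
  by rewrite bin_meanZ bin_mean_dev2 /c; field; rewrite !gt_eqF.
rewrite -cE; apply: bin_mean_le => // k kn.
have c0 : 0 < c by rewrite invr_gt0 exprn_gt0// mulr_gt0.
have [Sk|_] := boolP (S k); last by rewrite mulr_ge0 ?sqr_ge0// ltW.
have {Sk} := Ss _ kn Sk.
have -> : k%:R / n%:R - p = dev p n k / n%:R.
  by rewrite /dev; field; rewrite gt_eqF.
rewrite normrM normfV [`|n%:R|]gtr0_norm// ler_pdivlMr// => h.
rewrite /c mulrC ler_pdivlMr ?exprn_gt0 ?mulr_gt0// mul1r.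
rewrite -[leRHS]real_normK ?num_real// [n%:R * s]mulrC.
by rewrite lerXn2r// nnegrE ?mulr_ge0// ltW.
Qed.

Lemma bin_mean_markov (R : realType) n (p s : R) (S : nat -> bool) :
  (0 < n)%N -> 0 <= p <= 1 -> 0 < s ->
  (forall k, (k <= n)%N -> S k -> s <= k%:R / n%:R) ->
  bin_mean n p (fun k => (S k)%:R) <= p / s.
Proof.
move=> n0 p01 s0 Ss.
have n0R : 0 < n%:R :> R by rewrite ltr0n.
have kE k : k%:R = n%:R * p + dev p n k by rewrite /dev; ring.
have <- : bin_mean n p (fun k => (n%:R * s)^-1 * k%:R) = p / s.
  rewrite bin_meanZ (eq_bin_mean n p kE) bin_meanD bin_meanC bin_mean_dev.
  by field; rewrite !gt_eqF.
apply: bin_mean_le => // k kn.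
have [Sk|_] := boolP (S k); last by rewrite mulr_ge0// invr_ge0 mulr_ge0// ltW.
have {Sk} := Ss _ kn Sk.
by rewrite ler_pdivlMr// ler_pdivlMl ?mulr_gt0// mulr1 mulrC.
Qed.

(** A Paley-Zygmund argument at the fourth order, which bounds below the
    probability of an upward fluctuation.  Writing [D] for the deviation of the
    number of successes in units of [sqrt n], the polynomial
    [4 D + 4 D^2 - D^4 - 1/4] is at most 12 everywhere and negative for
    [D < 1/20], while its expectation is at least [1/4]: the linear term has mean
    0, the variance is bounded below, and the fourth moment is about three times
    the squared variance. *)
Lemma bin_mean_anticoncentration (R : realType) n (p : R) (S : nat -> bool) :
  (4 <= n)%N -> 0 <= p <= 1 -> 3 / 16 <= p * (1 - p) ->
  (forall k, (k <= n)%N -> 20^-1 / Num.sqrt n%:R <= k%:R / n%:R - p -> S k) ->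
  48^-1 <= bin_mean n p (fun k => (S k)%:R).
Proof.
move=> n4 p01 v0 Ss.
have n4R : 4 <= n%:R :> R by rewrite ler_nat.
have n0R : 0 < n%:R :> R by lra.
pose r : R := Num.sqrt n%:R.
have r0 : 0 < r by rewrite sqrtr_gt0.
have rr : r ^+ 2 = n%:R by rewrite sqr_sqrtr// ltW.
have r4 : r ^+ 4 = n%:R ^+ 2 by rewrite -rr -exprM.
pose D k := dev p n k / r.
have v1 := variance_le4 p.
suff : 4^-1 <= 12 * bin_mean n p (fun k => (S k)%:R) by lra.
rewrite -bin_meanZ.
have QE k : - 4^-1 + 4 * D k + 4 * D k ^+ 2 - D k ^+ 4 =
   - 4^-1 + (4 / r) * dev p n k + (4 / r ^+ 2) * dev p n k ^+ 2
   + 0 * dev p n k ^+ 3 + (- r ^- 4) * dev p n k ^+ 4.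
  by rewrite /D; field; rewrite gt_eqF.
apply: (@le_trans _ _ (bin_mean n p
    (fun k => - 4^-1 + 4 * D k + 4 * D k ^+ 2 - D k ^+ 4))).
  rewrite (eq_bin_mean n p QE) bin_mean_quartic.
  rewrite bin_mean_dev bin_mean_dev2 bin_mean_dev4 rr r4.
  set v := p * (1 - p) in v0 v1 *.
  have -> : - 4^-1 + 4 / r * 0 + 4 / n%:R * (n%:R * v) +
      0 * bin_mean n p (fun k => dev p n k ^+ 3) +
      - (n%:R ^+ 2)^-1 * (n%:R * v * (1 + 3 * (n%:R - 2) * v)) =
      - 4^-1 + 4 * v - 3 * v ^+ 2 - n%:R^-1 * (v * (1 - 6 * v)).
    by field; rewrite !gt_eqF.
  have n1 : n%:R^-1 <= 4^-1 :> R by rewrite lef_pV2// posrE; lra.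
  have n2 : 0 < n%:R^-1 :> R by rewrite invr_gt0.
  have : v * (1 - 6 * v) <= 0 by nra.
  by set u := v * _ => u0; nra.
apply: bin_mean_le => // k kn.
have DE : k%:R / n%:R - p = D k / r.
  by rewrite /D /dev -rr; field; rewrite gt_eqF.
have [Sk|/negP nSk] := boolP (S k).
  rewrite mulr1; move: (D k) => x.
  have := sqr_ge0 (x ^+ 2 - 3); have := sqr_ge0 (x - 1).
  suff -> : - 4^-1 + 4 * x + 4 * x ^+ 2 - x ^+ 4 =
      12 - (x ^+ 2 - 3) ^+ 2 - 2 * (x - 1) ^+ 2 - 5 / 4 by lra.
  by field.
have {nSk} Dk : D k < 20^-1.
  rewrite ltNge; apply/negP => h; apply: nSk; apply: Ss => //.
  by rewrite DE ler_pM2r// invr_gt0.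
rewrite mulr0; move: (D k) Dk => x xl.
have [x_ge0|x_lt0] := leP 0 x.
  by have := exprn_ge0 4 x_ge0; nra.
(* [t^3 - 4 t + 4 > 0] for [t = - x], from the tangent to [t^3] at [6/5] *)
have h : 0 <= (- x) * ((- x - 6 / 5) ^+ 2 * (- x + 12 / 5)).
  by apply: mulr_ge0; [lra | apply: mulr_ge0; [exact: sqr_ge0 | lra]].
have hE : - 4^-1 + 4 * x + 4 * x ^+ 2 - x ^+ 4 =
    - ((- x) * ((- x - 6 / 5) ^+ 2 * (- x + 12 / 5))) - 4^-1
    + 68 / 125 * x - 8 / 25 * x ^+ 2.
  by field.
rewrite hE; have := sqr_ge0 x; lra.
Qed.

(** * The transition operator and its iterates *)

(** The transition operator of the chain [X_t / n]: [step n f g y] is the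
    conditional expectation of [g] at the next state, given that the current
    one is [y]. *)
Definition step (R : realType) (n : nat) (f : R -> R) (g : R -> R) (y : R) : R :=
  bin_mean n (f y) (fun k => g (k%:R / n%:R)).

(** The states that the chain can take after its first step. *)
Definition grid (R : realType) (n : nat) (y : R) : Prop :=
  exists2 k : nat, (k <= n)%N & y = k%:R / n%:R.

Definition unit_map (R : realType) (f : R -> R) : Prop :=
  forall y, 0 <= y <= 1 -> 0 <= f y <= 1.

Lemma gridP (R : realType) n k : (k <= n)%N -> grid n (k%:R / n%:R : R).
Proof. by exists k. Qed.

Lemma grid01 (R : realType) n (y : R) : grid n y -> 0 <= y <= 1.
Proof.
move=> [k kn ->]; rewrite divr_ge0//=.
have [->|n0] := posnP n; first by rewrite invr0 mulr0.
by rewrite ler_pdivrMr ?ltr0n// mul1r ler_nat.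
Qed.

Lemma step_le (R : realType) n (f g1 g2 : R -> R) y : unit_map f ->
  0 <= y <= 1 -> (forall z, grid n z -> g1 z <= g2 z) ->
  step n f g1 y <= step n f g2 y.
Proof.
move=> f01 y01 g12; apply: bin_mean_le; first exact: f01.
by move=> k kn; apply/g12/gridP.
Qed.

Lemma eq_step (R : realType) n (f g1 g2 : R -> R) y :
  (forall z, grid n z -> g1 z = g2 z) -> step n f g1 y = step n f g2 y.
Proof. by move=> g12; apply: eq_in_bin_mean => k kn; exact/g12/gridP. Qed.

Lemma step_cst (R : realType) n (f : R -> R) c y : step n f (fun=> c) y = c.
Proof. exact: bin_meanC. Qed.

Lemma step_refl (R : realType) n (f g : R -> R) y : (0 < n)%N ->
  f (1 - y) = 1 - f y -> (forall z, g (1 - z) = g z) ->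
  step n f g (1 - y) = step n f g y.
Proof.
move=> n0 fy gsym; rewrite /step fy bin_mean_refl; apply: eq_in_bin_mean => k kn.
rewrite -gsym natrB//; congr g; field.
by rewrite pnatr_eq0 -lt0n.
Qed.

Lemma iter_step_bounded (R : realType) n (f w : R -> R) t y (D : R -> Prop) :
  unit_map f -> (forall z, D z -> 0 <= z <= 1) -> (forall z, grid n z -> D z) ->
  (forall z, D z -> 0 <= w z <= 1) -> D y ->
  0 <= iter t (step n f) w y <= 1.
Proof.
move=> f01 D01 Dgrid w01; elim: t y => [|t IH] y Dy /=; first exact: w01.
have y01 := D01 _ Dy.
apply/andP; split.
  by rewrite -[leLHS](step_cst n f 0 y); apply: step_le => // z /Dgrid /IH /andP[].
by rewrite -[leRHS](step_cst n f 1 y); apply: step_le => // z /Dgrid /IH /andP[].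
Qed.

(** If each move of the chain from the i-th set leads into the next set with
    probability at least [1 - delta i], then a chain started in the first
    set is in the last one except with probability [\sum_i delta i]; [w] is
    any cost which is at most [eps] there.  The set [D] of admissible states has
    to contain the grid, where the chain lives after one step, but may also
    contain an arbitrary starting point. *)
Lemma iter_step_chain (R : realType) n (f w : R -> R) (D : R -> Prop)
    (eps : R) T (A : nat -> R -> bool) (delta : nat -> R) y :
  unit_map f -> (forall z, D z -> 0 <= z <= 1) -> (forall z, grid n z -> D z) ->
  (forall z, D z -> 0 <= w z <= 1) -> 0 <= eps ->
  (forall i, (i < T)%N -> 0 <= delta i) ->
  (forall i z, (i < T)%N -> D z -> A i z ->
     step n f (fun z' => (~~ A i.+1 z')%:R) z <= delta i) ->
  (forall z, D z -> A T z -> w z <= eps) ->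
  D y -> A 0%N y ->
  iter T (step n f) w y <= eps + \sum_(i < T) delta i.
Proof.
move=> f01 D01 Dgrid w01 eps0.
elim: T A delta y => [|T IH] A delta y delta0 Astep AT Dy Ay.
  by rewrite big_ord0 addr0; exact: AT.
rewrite big_ord_recl/=.
set S := \sum_(i < T) _.
have S0 : 0 <= S by apply: sumr_ge0 => i _; exact: (delta0 i.+1 (ltn_ord i)).
apply: (@le_trans _ _ (step n f (fun z => (eps + S) + (~~ A 1%N z)%:R) y)).
  apply: step_le => // [|z gz]; first exact: D01.
  have Dz := Dgrid _ gz.
  have [A1|_] := boolP (A 1%N z); last first.
    have /andP[_ h] := iter_step_bounded T f01 D01 Dgrid w01 Dz.
    by rewrite /= (le_trans h)// lerDr addr_ge0.
  rewrite /= addr0.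
  apply: (IH (fun i => A i.+1) (fun i => delta i.+1)) => // i iT.
    exact: delta0.
  by move=> Dz'; exact: (Astep i.+1).
rewrite /step bin_meanD bin_meanC [delta _ + _]addrC addrA lerD2l.
exact: Astep.
Qed.

Lemma iter_step_nonincr (R : realType) n (f w : R -> R) s t y :
  unit_map f -> (forall z, grid n z -> step n f w z <= w z) -> grid n y ->
  iter (s + t) (step n f) w y <= iter t (step n f) w y.
Proof.
move=> f01 wdecr; elim: s y => [//|s IH] y gy; apply: le_trans (IH _ gy).
rewrite addSn; elim: (s + t)%N y gy => [|r IHr] y gy; first exact: wdecr.
by apply: (@step_le _ n f _ _ y) => //; exact: grid01 gy.
Qed.

(** A chain which from everywhere can climb in L steps, with probability at
    least [c ^+ L], to a set where the cost after time [t] is at most [eps],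
    fails to do so within [j] rounds of L steps only with geometrically small
    probability.  The cost is nonincreasing in time, so the random time of the
    climb is harmless. *)
Lemma iter_step_climb (R : realType) n (f w : R -> R) (A : nat -> R -> bool)
    (L t : nat) (c eps : R) j y :
  unit_map f -> (forall z, grid n z -> 0 <= w z <= 1) ->
  (forall z, grid n z -> step n f w z <= w z) ->
  0 <= c <= 1 -> 0 <= eps ->
  (forall z, grid n z -> A 0%N z) ->
  (forall i z, (i < L)%N -> grid n z -> A i z -> ~~ A i.+1 z ->
     c <= step n f (fun z' => (A i.+1 z')%:R) z) ->
  (forall z, grid n z -> A L z -> iter t (step n f) w z <= eps) ->
  grid n y ->
  iter (j * L + t) (step n f) w y <= eps + (1 - c ^+ L) ^+ j.
Proof.
move=> f01 w01 wdecr /andP[c0 c1] eps0 A0 Aup AL.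
have c01 i : 0 <= c ^+ i <= 1 by rewrite exprn_ge0// exprn_ile1.
elim: j y => [|j IH] y gy.
  rewrite expr0 mul0n add0n (@le_trans _ _ 1) ?lerDr//.
  by have /andP[] := iter_step_bounded t f01 (@grid01 R n) (fun z h => h) w01 gy.
set sigma := eps + _ in IH.
have es : eps <= sigma.
  rewrite /sigma lerDl exprn_ge0// subr_ge0; by case/andP: (c01 L).
suff H i z : (i <= L)%N -> grid n z -> A (L - i)%N z ->
    iter (i + (j * L + t)) (step n f) w z <= c ^+ i * eps + (1 - c ^+ i) * sigma.
  have := H L y (leqnn L) gy; rewrite subnn mulSn -addnA => /(_ (A0 _ gy)) h.
  apply: (le_trans h); rewrite /sigma exprS; lra.
elim: i z => [|i IHi] z iL gz Az.
  rewrite expr0 mul1r subrr mul0r addr0 add0n.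
  apply: le_trans (AL _ gz _); last by rewrite subn0 in Az.
  exact: iter_step_nonincr.
have LE : (L - i = (L - i.+1).+1)%N by rewrite -subSn.
have mono : c ^+ i * eps + (1 - c ^+ i) * sigma <=
    c ^+ i.+1 * eps + (1 - c ^+ i.+1) * sigma.
  have : c ^+ i.+1 <= c ^+ i.
    by rewrite exprS ler_piMl//; case/andP: (c01 i).
  nra.
have [Az'|nAz] := boolP (A (L - i)%N z).
  rewrite addSn -add1n; apply: le_trans mono.
  apply: le_trans (IHi _ (ltnW iL) gz Az').
  exact: (@iter_step_nonincr R n f w 1).
have iL' : (L - i.+1 < L)%N by rewrite ltn_subrL /= (leq_trans _ iL).
have := Aup _ z iL' gz Az; rewrite -LE => /(_ nAz) up.
set B := c ^+ i * eps + (1 - c ^+ i) * sigma in IHi mono.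
have Bs : B <= sigma.
  by have := c01 i => /andP[h _]; rewrite /B; nra.
rewrite addSn /=.
apply: (@le_trans _ _ (step n f
    (fun z' => sigma + (B - sigma) * (A (L - i)%N z')%:R) z)).
  apply: step_le => // [|z' gz']; first exact: grid01 gz.
  have [Az'|_] := boolP (A (L - i)%N z').
    by rewrite mulr1 addrC subrK; exact: IHi (ltnW iL) gz' Az'.
  rewrite mulr0 addr0; apply: le_trans (IH _ gz').
  exact: iter_step_nonincr.
rewrite /step bin_meanD bin_meanZ bin_meanC -/(step n f (fun z' => (A (L - i)%N z')%:R) z).
rewrite /B exprS; move: up; set u := step _ _ _ _ => up.
have : (B - sigma) * u <= (B - sigma) * c by rewrite ler_wnM2l// subr_le0.
rewrite /B; lra.
Qed.

Lemma step_chebyshev (R : realType) n (f : R -> R) (S : R -> bool) (s y : R) :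
  (0 < n)%N -> unit_map f -> 0 <= y <= 1 -> 0 < s ->
  (forall z, grid n z -> S z -> s <= `|z - f y|) ->
  step n f (fun z => (S z)%:R) y <= (4 * n%:R * s ^+ 2)^-1.
Proof.
move=> n0 f01 y01 s0 Ss.
have n0R : 0 < n%:R :> R by rewrite ltr0n.
have h := @bin_mean_chebyshev R n (f y) s (fun k => S (k%:R / n%:R)) n0 (f01 _ y01) s0.
apply: le_trans (h _) _ => [k kn|]; first exact/Ss/gridP.
have : (f y) * (1 - f y) <= 4^-1 := variance_le4 _.
have q0 : 0 < n%:R * s ^+ 2 by rewrite mulr_gt0 ?exprn_gt0.
rewrite ler_pdivrMr// => /le_trans; apply.
by rewrite le_eqVlt; apply/orP; left; apply/eqP; field; rewrite !gt_eqF.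
Qed.

(** * Majority-type update functions *)

Section update_function.
Context (R : realType) (m : nat) (beta gamma : R) (f : R -> R).
Hypothesis hf : majority_type_update m beta gamma f.

Let itv01 (y : R) : (y \in `[0, 1]) = (0 <= y <= 1).
Proof. by rewrite in_itv. Qed.

Lemma update_unit_map : unit_map f.
Proof.
by move=> y y01; have := majority_range hf (x := y); rewrite !itv01; exact.
Qed.

Lemma update_refl y : 0 <= y <= 1 -> f (1 - y) = 1 - f y.
Proof.
move=> y01; have := majority_symm hf (x := y); rewrite itv01 => /(_ y01).
by move=> <-; rewrite opprB addrCA subrr addr0.
Qed.

Let at0 : exists k r : R, [/\ 0 < k, 0 < r & forall x, 0 <= x <= 1 -> x < r ->
  `|f x - beta * x ^+ m| <= k * x ^+ m.+1].
Proof.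
have /eqO_exP[k k0] := majority_at0 hf.
move=> /nbhs_ballP[r /= r0 Hr]; exists k, r; split=> // x /andP[x0 x1] xr.
have := Hr x; rewrite /ball /= sub0r normrN ger0_norm// => /(_ xr).
rewrite /= in_itv /= x0 x1 => /(_ isT) h; apply: le_trans h _.
by rewrite [`|x ^+ _|]ger0_norm// exprn_ge0.
Qed.

Let at_half : exists k r : R, [/\ 0 < k, 0 < r & forall x, 0 <= x < r ->
  `|2^-1 - f (2^-1 - x) - gamma * x| <= k * x ^+ 2].
Proof.
have /eqO_exP[k k0] := majority_at_half hf.
move=> /nbhs_ballP[r /= r0 Hr]; exists k, r; split=> // x /andP[x0 xr].
have := Hr (- x); rewrite /ball /= sub0r opprK ger0_norm// => /(_ xr) h.
rewrite -normrN; apply: le_trans (_ : _ <= k * `|(- x) ^+ 2|) _.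
  by apply: le_trans h; rewrite le_eqVlt; apply/orP; left; apply/eqP; congr `|_|; ring.
by rewrite sqrrN ger0_norm// exprn_ge0.
Qed.

Lemma update0 : f 0 = 0.
Proof.
have [k [r [k0 r0 /(_ 0)]]] := at0; rewrite lexx ler01 => /(_ isT r0).
have m0 : (0 < m)%N by have := majority_m_ge2 hf; exact: ltnW.
by rewrite !expr0n /= gtn_eqF// !mulr0 subr0 normr_le0 => /eqP.
Qed.

Lemma update_half : f 2^-1 = 2^-1.
Proof.
by have := @update_refl 2^-1; rewrite (_ : 1 - 2^-1 = 2^-1); [lra|field].
Qed.

Lemma update_convex t x y : 0 <= t <= 1 -> 0 <= x <= 2^-1 -> 0 <= y <= 2^-1 ->
  f (t * x + (1 - t) * y) <= t * f x + (1 - t) * f y.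
Proof.
move=> /andP[t0 t1] xh yh.
have := @majority_convex _ _ _ _ _ hf (Itv01 t0 t1) x y.
rewrite !convRE /= /unstable.onem; apply; rewrite inE /= in_itv //=.
Qed.

(** The case of convexity in which one end of the chord is the fixed point 0; it
    says that [f x / x] is nondecreasing. *)
Lemma update_star t x : 0 <= t <= 1 -> 0 <= x <= 2^-1 -> f (t * x) <= t * f x.
Proof.
move=> t01 xh; have := @update_convex t x 0 t01 xh.
by rewrite update0 !mulr0 !addr0; apply; lra.
Qed.

Lemma update_le_id x : 0 <= x <= 2^-1 -> f x <= x.
Proof.
move=> xh; have := @update_star (2 * x) 2^-1.
rewrite update_half (_ : 2 * x * 2^-1 = x); last by field.
by apply; lra.
Qed.

Lemma update_mono x y : 0 <= x -> x <= y -> y <= 2^-1 -> f x <= f y.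
Proof.
move=> x0 xy yh.
have [y0|y_gt0] := leP y 0.
  by rewrite (_ : x = y)//; lra.
have h : f (x / y * y) <= x / y * f y.
  apply: update_star; last by rewrite (ltW y_gt0).
  by rewrite divr_ge0 ?(ltW y_gt0)//= ler_pdivrMr// mul1r.
rewrite divfK ?gt_eqF// in h; apply: (le_trans h).
rewrite ler_piMl//.
  by suff /andP[] : 0 <= f y <= 1 by []; apply: update_unit_map; lra.
by rewrite ler_pdivrMr// mul1r.
Qed.

(** By convexity the graph of [f] on [0, 1/2] is above its tangent at 1/2. *)
Lemma update_slope_le x : 0 <= x <= 2^-1 -> 2^-1 - f (2^-1 - x) <= gamma * x.
Proof.
move=> xh; have [k [r [k0 r0 H]]] := at_half.
apply/ler_addgt0Pr => e e0.
(* the chord from [2^-1 - x] to [2^-1], cut at the small proportion [s] where the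
   expansion of [f] at [2^-1] applies with an error at most [s * e] *)
have x1 : 0 < k * x ^+ 2 + 1 by have := sqr_ge0 x; nra.
have x2 : 0 < x + 1 by lra.
pose s := Num.min 1 (Num.min (e / (k * x ^+ 2 + 1)) (r / (x + 1) / 2)).
have s0 : 0 < s by rewrite !lt_min ltr01 !divr_gt0.
have s1 : s <= 1 by rewrite !ge_min lexx.
have se : s * (k * x ^+ 2 + 1) <= e.
  by rewrite -ler_pdivlMr// !ge_min lexx !orbT.
have sr : s * (x + 1) < r.
  apply: (@le_lt_trans _ _ (r / 2)); last by lra.
  rewrite -ler_pdivlMr// (_ : r / 2 / (x + 1) = r / (x + 1) / 2); last first.
    by field; rewrite gt_eqF.
  by rewrite !ge_min lexx !orbT.
have : `|2^-1 - f (2^-1 - s * x) - gamma * (s * x)| <= k * (s * x) ^+ 2.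
  by apply: H; nra.
have := @update_convex s (2^-1 - x) 2^-1.
rewrite update_half (_ : s * (2^-1 - x) + (1 - s) * 2^-1 = 2^-1 - s * x); last first.
  by field.
move=> cv; have {}cv : f (2^-1 - s * x) <= s * f (2^-1 - x) + (1 - s) * 2^-1.
  by apply: cv; lra.
rewrite ler_norml => /andP[_ h].
have key : s * (2^-1 - f (2^-1 - x)) <= s * (gamma * x + s * (k * x ^+ 2)) by nra.
rewrite ler_pM2l// in key; apply: (le_trans key); nra.
Qed.

(** Near 1/2 this is the expansion of [f]; at a distance at least [r] from 1/2
    the constant is so large that the left-hand side is at most 0. *)
Lemma update_slope_ge : exists2 C, 0 < C &
  forall x, 0 <= x <= 2^-1 -> gamma * x - C * x ^+ 2 <= 2^-1 - f (2^-1 - x).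
Proof.
have [k [r [k0 r0 H]]] := at_half.
have g1 := majority_gamma_gt1 hf.
exists (k + gamma / r); first by rewrite addr_gt0// divr_gt0//; lra.
move=> x /andP[x0 xh]; have [xr|rx] := ltP x r.
  have : `|2^-1 - f (2^-1 - x) - gamma * x| <= k * x ^+ 2 by apply: H; rewrite x0.
  rewrite ler_norml => /andP[h _].
  have : 0 <= gamma / r * x ^+ 2.
    by rewrite mulr_ge0 ?sqr_ge0// divr_ge0 ?(ltW r0)//; lra.
  by move: h; set u := gamma / r; set v := x ^+ 2; lra.
have : f (2^-1 - x) <= 2^-1 - x by apply: update_le_id; lra.
have : gamma * x <= gamma / r * x ^+ 2.
  rewrite expr2 mulrA ler_wpM2r// mulrAC ler_pdivlMr// ler_wpM2l//; lra.
have : 0 <= k * x ^+ 2 by rewrite mulr_ge0 ?sqr_ge0// ltW.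
set u := gamma / r; set v := x ^+ 2; lra.
Qed.

(** Near 0 this is the expansion of [f], and monotonicity extends it at the
    price of the constant. *)
Lemma update_ge_pow : exists2 c, 0 < c <= 1 &
  forall x, 0 <= x <= 2^-1 -> c * x ^+ m <= f x.
Proof.
have [k [r [k0 r0 H]]] := at0.
have b0 := majority_beta_gt0 hf.
pose s := Num.min 2^-1 (Num.min (beta / (2 * k)) (r / 2)).
have s0 : 0 < s by rewrite !lt_min invr_gt0 ltr0n !divr_gt0// mulr_gt0.
have s2 : s <= 2^-1 by rewrite !ge_min lexx.
have sb : k * s <= beta / 2.
  have : s <= beta / (2 * k) by rewrite !ge_min lexx !orbT.
  by rewrite ler_pdivlMr ?mulr_gt0//; lra.
have sr : s < r.
  have : s <= r / 2 by rewrite !ge_min lexx !orbT.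
  lra.
have near0 x : 0 <= x <= s -> beta / 2 * x ^+ m <= f x.
  move=> /andP[x0 xs]; have : `|f x - beta * x ^+ m| <= k * x ^+ m.+1 by apply: H; lra.
  rewrite ler_norml exprS => /andP[h _].
  have xm : 0 <= x ^+ m by rewrite exprn_ge0.
  have : k * x <= beta / 2 by nra.
  nra.
have sm0 : 0 < s ^+ m by rewrite exprn_gt0.
have sm1 : s ^+ m <= 1 by rewrite exprn_ile1//; lra.
pose c := Num.min 1 (beta / 2 * s ^+ m).
have c0 : 0 < c by rewrite lt_min ltr01 mulr_gt0// divr_gt0.
exists c; first by rewrite c0 !ge_min lexx.
have cb : c <= beta / 2 * s ^+ m by rewrite !ge_min lexx orbT.
move=> x /andP[x0 xh].
have xm : 0 <= x ^+ m by rewrite exprn_ge0.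
have xm1 : x ^+ m <= 1 by rewrite exprn_ile1//; lra.
have [xs|sx] := leP x s.
  apply: le_trans (near0 x _); last by rewrite x0.
  rewrite ler_wpM2r//; apply: (le_trans cb); rewrite ler_piMr//; lra.
apply: le_trans (update_mono (ltW s0) (ltW sx) xh).
apply: le_trans (near0 s _); last by rewrite lexx (ltW s0).
nra.
Qed.

Lemma update_le_pow : exists2 C, 0 < C &
  forall x, 0 <= x <= 1 -> f x <= C * x ^+ m.
Proof.
have [k [r [k0 r0 H]]] := at0.
have b0 := majority_beta_gt0 hf.
have rm0 : 0 < r ^+ m by rewrite exprn_gt0.
exists (beta + k + r ^- m); first by rewrite !addr_gt0// invr_gt0.
move=> x x01; have /andP[x0 x1] := x01.
have xm : 0 <= x ^+ m by rewrite exprn_ge0.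
rewrite !mulrDl.
have bx : 0 <= beta * x ^+ m by rewrite mulr_ge0// ltW.
have kx : 0 <= k * x ^+ m by rewrite mulr_ge0// ltW.
have [xr|rx] := ltP x r.
  have := H x x01 xr; rewrite ler_norml exprS => /andP[_ h].
  have : k * (x * x ^+ m) <= k * x ^+ m.
    by rewrite ler_wpM2l ?(ltW k0)// ler_piMl.
  have : 0 <= r ^- m * x ^+ m by rewrite mulr_ge0// invr_ge0 ltW.
  set u := r ^- m; lra.
have : 1 <= r ^- m * x ^+ m.
  by rewrite mulrC ler_pdivlMr// mul1r lerXn2r// nnegrE ltW.
have /andP[_] : 0 <= f x <= 1 by exact: update_unit_map.
set u := r ^- m; lra.
Qed.

(** Since the slope of [f] at 1/2 is larger than 1, the graph passes under the
    diagonal at some point near 1/2; by convexity it is under the chord from the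
    origin to that point, whose slope is less than 1. *)
Lemma update_contract eta : 0 < eta < 2^-1 -> exists2 kappa, 0 < kappa < 1 &
  forall x, 0 <= x <= 2^-1 - eta -> f x <= kappa * x.
Proof.
move=> /andP[e0 eh]; have [C C0 H] := update_slope_ge.
have g1 := majority_gamma_gt1 hf.
pose d := Num.min eta ((gamma - 1) / (2 * C)).
have d0 : 0 < d by rewrite lt_min e0 divr_gt0 ?mulr_gt0// subr_gt0.
have de : d <= eta by rewrite ge_min lexx.
have dC : C * d <= (gamma - 1) / 2.
  have : d <= (gamma - 1) / (2 * C) by rewrite ge_min lexx orbT.
  by rewrite ler_pdivlMr ?mulr_gt0//; lra.
set y := 2^-1 - d; have y0 : 0 < y by rewrite /y; lra.
have fy : f y < y.
  have : gamma * d - C * d ^+ 2 <= 2^-1 - f y by apply: H; lra.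
  rewrite expr2 mulrA /y; nra.
have fy0 : 0 <= f y.
  suff /andP[] : 0 <= f y <= 1 by [].
  by apply: update_unit_map; rewrite /y; lra.
pose kappa := Num.max (f y / y) 2^-1.
have k1 : f y / y <= kappa by rewrite le_max lexx.
exists kappa.
  rewrite lt_max gt_max ltr_pdivrMr// mul1r fy; apply/andP; split; last by lra.
  by apply/orP; right; lra.
move=> x /andP[x0 xe].
have xy : x <= y by rewrite /y; lra.
have : f (x / y * y) <= x / y * f y.
  apply: update_star; last by rewrite /y; lra.
  by rewrite divr_ge0 ?(ltW y0)//= ler_pdivrMr// mul1r.
rewrite divfK ?gt_eqF// => h; apply: (le_trans h).
by rewrite mulrAC -mulrA mulrC ler_wpM2r.
Qed.

End update_function.

(** * One step of the chain, up to exchanging the opinions *)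

Definition minority (R : realType) (y : R) : R := Num.min y (1 - y).

Definition undecided (R : realType) (y : R) : R := ((y != 0) && (y != 1))%:R.

Lemma sum_geometric_le (R : realType) (q : R) T : 0 <= q < 1 ->
  \sum_(i < T) q ^+ i <= (1 - q)^-1.
Proof.
move=> /andP[q0 q1]; have q1' : 0 < 1 - q by rewrite subr_gt0.
rewrite -[leRHS]mul1r ler_pdivlMr// mulrC.
have := subrX1 q T; have := exprn_ge0 T q0.
set S := \sum_(i < T) _; nra.
Qed.

Lemma exprn_small (R : realType) (q e : R) : 0 <= q < 1 -> 0 < e ->
  exists T, q ^+ T <= e.
Proof.
move=> q01 e0; have /andP[q0 q1] := q01.
have q1' : 0 < 1 - q by rewrite subr_gt0.
have c0 : 0 < (1 - q)^-1 / e by rewrite divr_gt0// invr_gt0.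
exists (Num.truncn ((1 - q)^-1 / e)).+1.
set T := _.+1.
have TgtC : (1 - q)^-1 / e <= T%:R by rewrite ltW// truncnS_gt.
have T0 : 0 < T%:R :> R by rewrite ltr0n.
rewrite -(ler_pM2l T0).
apply: (@le_trans _ _ (1 - q)^-1); last by rewrite -ler_pdivrMr.
apply: le_trans (sum_geometric_le T q01).
rewrite mulr_natl -[X in _ *+ X]card_ord -sumr_const.
apply: ler_sum => i _; apply: ler_wiXn2l => //; [exact: ltW | exact/ltnW].
Qed.

Lemma minority_refl (R : realType) (y : R) : minority (1 - y) = minority y.
Proof. by rewrite /minority opprB addrCA subrr addr0 minC. Qed.

Lemma minority_itv (R : realType) (y : R) : 0 <= y <= 1 ->
  0 <= minority y <= 2^-1.
Proof.
by rewrite /minority => y01; case: (leP y (1 - y)) => h; lra.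
Qed.

Lemma le_minority (R : realType) (l y : R) :
  (l <= minority y) = (l <= y) && (y <= 1 - l).
Proof. by rewrite /minority le_min; congr (_ && _); apply/idP/idP; lra. Qed.

Lemma lt_minority (R : realType) (l y : R) :
  (l < minority y) = (l < y) && (y < 1 - l).
Proof. by rewrite /minority lt_min; congr (_ && _); apply/idP/idP; lra. Qed.

Section one_step.
Context (R : realType) (m : nat) (beta gamma : R) (f : R -> R) (n : nat).
Hypothesis hf : majority_type_update m beta gamma f.
Hypothesis n0 : (0 < n)%N.

(** The two opinions play symmetric parts, so one may assume that the first one
    is in the minority. *)
Lemma step_minority (g : R -> R) y : 0 <= y <= 1 ->
  (forall z, g (1 - z) = g z) -> step n f g y = step n f g (minority y).
Proof.
move=> y01 gsym; rewrite /minority; case: leP => // _.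
by rewrite step_refl//; exact: update_refl hf _ y01.
Qed.

Lemma update_minority y : 0 <= y <= 1 -> 0 <= f (minority y) <= 2^-1.
Proof.
move=> /minority_itv xh.
have /andP[-> _] : 0 <= f (minority y) <= 1.
  by apply: (update_unit_map hf); lra.
by have := update_le_id hf xh; lra.
Qed.

Lemma step_minority_le (l s y : R) : 0 <= y <= 1 -> 0 < s ->
  f (minority y) <= l - s ->
  step n f (fun z => (~~ (minority z <= l))%:R) y <= (4 * n%:R * s ^+ 2)^-1.
Proof.
move=> y01 s0 fl; rewrite step_minority//; last by move=> z; rewrite minority_refl.
have xh := minority_itv y01.
apply: (@step_chebyshev _ _ _ (fun z => ~~ (minority z <= l))) => //.
- exact: update_unit_map hf.
- by lra.
move=> z gz; rewrite -ltNge lt_minority => /andP[lz _].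
by rewrite ler_normr; apply/orP; left; lra.
Qed.

Lemma step_minority_ge (l s y : R) : 0 <= y <= 1 -> 0 < s ->
  l + s <= f (minority y) ->
  step n f (fun z => (~~ (l <= minority z))%:R) y <= (4 * n%:R * s ^+ 2)^-1.
Proof.
move=> y01 s0 fl; rewrite step_minority//; last by move=> z; rewrite minority_refl.
have xh := minority_itv y01.
have fh := update_minority y01.
apply: (@step_chebyshev _ _ _ (fun z => ~~ (l <= minority z))) => //.
- exact: update_unit_map hf.
- by lra.
move=> z gz; rewrite le_minority negb_and -!ltNge ler_normr => /orP[] h.
  by apply/orP; right; lra.
by apply/orP; left; lra.
Qed.

Lemma step_minority_markov (l y : R) : 0 <= y <= 1 -> 0 < l ->
  step n f (fun z => (~~ (minority z <= l))%:R) y <= f (minority y) / l.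
Proof.
move=> y01 l0; rewrite step_minority//; last by move=> z; rewrite minority_refl.
have xh := minority_itv y01.
apply: (@bin_mean_markov _ n _ l (fun k => ~~ (minority (k%:R / n%:R) <= l))) => //.
  by apply: (update_unit_map hf); lra.
by move=> k kn; rewrite -ltNge lt_minority => /andP[/ltW].
Qed.

(** The mean already moves towards consensus, since [f x <= x] for [x <= 1/2];
    so a fluctuation of order [1 / sqrt n] in that direction has a
    probability bounded below, as long as the variance is. *)
Lemma step_minority_fluctuation (y : R) : (4 <= n)%N -> 0 <= y <= 1 ->
  4^-1 <= f (minority y) ->
  48^-1 <= step n f
    (fun z => (minority z <= minority y - 20^-1 / Num.sqrt n%:R)%R%:R) y.
Proof.
move=> n4 y01 fy.
have xh := minority_itv y01.
have fh := update_minority y01.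
have fx := update_le_id hf xh.
rewrite step_minority//; last by move=> z; rewrite minority_refl.
set x := minority y in xh fh fx fy *.
have -> : x = 1 - (1 - x) by ring.
rewrite step_refl//; last first.
- by move=> z; rewrite minority_refl.
- by rewrite !(update_refl hf)//; lra.
set s := 20^-1 / _.
apply: (@bin_mean_anticoncentration _ n _
  (fun k => minority (k%:R / n%:R) <= 1 - (1 - x) - s)) => //.
- by rewrite (update_refl hf); lra.
- by rewrite (update_refl hf); nra.
move=> k kn; rewrite (update_refl hf); last by lra.
by move=> h; rewrite /minority ge_min; apply/orP; right; rewrite -/s in h; lra.
Qed.

End one_step.

Lemma undecided01 (R : realType) (y : R) : 0 <= undecided y <= 1.
Proof. by rewrite ler0n lern1 leq_b1. Qed.

(** Consensus is absorbing, because [f] fixes 0 and 1. *)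
Lemma step_undecided_decr (R : realType) m (beta gamma : R) f n
    (hf : majority_type_update m beta gamma f) y :
  (0 < n)%N -> 0 <= y <= 1 -> step n f (@undecided R) y <= undecided y.
Proof.
move=> n0 y01; have nN0 : n%:R != 0 :> R by rewrite pnatr_eq0 -lt0n.
have sym z : undecided (1 - z) = undecided z :> R.
  rewrite /undecided andbC; congr (nat_of_bool (~~ _ && ~~ _))%:R;
  by apply/eqP/eqP; lra.
suff H : step n f (@undecided R) 0 = 0.
  rewrite {2}/undecided; case: (eqVneq y 0) => [->|y0]; first by rewrite H.
  case: (eqVneq y 1) => [->|y1] /=.
    by rewrite -(subr0 1) (step_refl n0)// ?H// (update_refl hf)//; lra.
  rewrite -[leRHS](step_cst n f 1 y); apply: step_le => //.
    exact: update_unit_map hf.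
  by move=> z _; case/andP: (undecided01 z).
apply/eqP; rewrite eq_le; apply/andP; split; last first.
  rewrite -[leLHS](step_cst n f 0 0); apply: step_le.
  - exact: update_unit_map hf.
  - by lra.
  - by move=> z _; case/andP: (undecided01 z).
pose S (k : nat) := (k%:R / n%:R != 0 :> R) && (k%:R / n%:R != 1 :> R).
have ninv : 0 < n%:R^-1 :> R by rewrite invr_gt0 ltr0n.
have := @bin_mean_markov R n (f 0) n%:R^-1 S n0.
rewrite (update0 hf) mul0r => /(_ _ ninv) h; rewrite /step (update0 hf).
apply: h; first by lra.
move=> k kn /andP[k0 _]; rewrite ler_peMl ?(ltW ninv)// ler1n lt0n.
by apply: contra k0 => /eqP->; rewrite mul0r.
Qed.

(** * Consensus is reached fast *)

Lemma endgame_exponent m i X : (2 <= m)%N ->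
  (i.+1 + (m * X + i.+1 + 2) <= (X + i + 2) * m)%N.
Proof.
move=> m2; have := leq_mul m2 (leqnn i.+2).
by rewrite !mulnDl !mulnS [(X * m)%N]mulnC; lia.
Qed.

Lemma chebyshev_ge0 (R : realType) n (s : R) : 0 <= (4 * n%:R * s ^+ 2)^-1.
Proof.
by rewrite invr_ge0; apply: mulr_ge0; [exact: mulr_ge0 | exact: sqr_ge0].
Qed.

Section consensus_is_fast.
Context (R : realType) (m : nat) (beta gamma : R) (f : R -> R).
Hypothesis hf : majority_type_update m beta gamma f.

Let fu : unit_map f. Proof. exact: update_unit_map hf. Qed.

(** A minority of fraction [y] has mean at most [C y^m] after a step, so
    Markov's inequality lets it follow the doubly exponential levels
    [q ^ (m ^ i + i + 2)], the term [i] paying for a summable probability of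
    failure.  A minority below [1 / n] has disappeared. *)
Lemma endgame (eps : R) : 0 < eps -> exists2 q : R, 0 < q <= 2^-1 &
  forall n T y, (0 < n)%N -> q ^+ (m ^ T) * n%:R <= 1 ->
    grid n y -> minority y <= q ^+ 3 ->
    iter T (step n f) (@undecided R) y <= eps.
Proof.
move=> e0; have [C C0 fC] := update_le_pow hf.
have m2 := majority_m_ge2 hf.
pose q : R := Num.min 2^-1 (eps / (2 * C)).
have q0 : 0 < q by rewrite lt_min invr_gt0 ltr0n divr_gt0// mulr_gt0.
have qh : q <= 2^-1 by rewrite ge_min lexx.
have qe : 2 * C * q <= eps.
  by rewrite mulrC -ler_pdivlMr ?mulr_gt0// ge_min lexx orbT.
exists q; first by rewrite q0.
move=> n T y n0 qT gy yq.
pose l i := q ^+ (m ^ i + i + 2).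
have l0 i : 0 < l i by rewrite exprn_gt0.
pose delta i := C * q * q ^+ i.
have sumdelta : \sum_(i < T) delta i <= eps.
  rewrite -mulr_sumr.
  have q01 : 0 <= q < 1 by lra.
  have := sum_geometric_le T q01; have : (1 - q)^-1 <= 2.
    by rewrite -[leRHS]invrK lef_pV2// ?posrE ?invr_gt0//; lra.
  set S := \sum_(i < T) _ => h1 h2.
  have : C * q * S <= C * q * 2 by apply: ler_wpM2l; [apply: mulr_ge0; exact: ltW | lra].
  lra.
suff H : iter T (step n f) (@undecided R) y <= 0 + \sum_(i < T) delta i.
  by apply: (le_trans H); rewrite add0r.
apply: (iter_step_chain (D := grid n) (A := fun i z => minority z <= l i)) => //.
- exact: grid01.
- by move=> z _; exact: undecided01.
- by move=> i _; rewrite !mulr_ge0// ?exprn_ge0 ?ltW.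
- move=> i z _ /grid01 z01 zl.
  apply: le_trans (step_minority_markov hf n0 z01 (l0 i.+1)) _.
  have xh := minority_itv z01.
  rewrite ler_pdivrMr//; apply: le_trans (fC _ _) _; first by lra.
  rewrite -!mulrA ler_pM2l//.
  apply: (@le_trans _ _ (l i ^+ m)).
    by apply: lerXn2r; rewrite ?nnegrE ?(ltW (l0 _))//; case/andP: xh.
  rewrite /l -exprM -exprD -exprS; apply: ler_wiXn2l; [exact: ltW|by lra|].
  by rewrite expnS; exact: endgame_exponent.
- move=> z [k kn ->] zl.
  have nR : 0 < n%:R :> R by rewrite ltr0n.
  have ln : l T < n%:R^-1.
    apply: (@lt_le_trans _ _ (q ^+ (m ^ T))); last first.
      by rewrite -[leRHS]mul1r ler_pdivlMr.
    by rewrite /l -addnA exprD gtr_pMr ?exprn_gt0// exprn_ilt1 ?addn2//; lra.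
  have := le_lt_trans zl ln; rewrite /minority gt_min => /orP[].
    rewrite ltr_pdivrMr// mulVf ?gt_eqF// ltrn1 ltnS leqn0 => /eqP->.
    by rewrite /undecided mul0r eqxx.
  have -> : 1 - k%:R / n%:R = (n - k)%:R / n%:R :> R.
    by rewrite natrB//; field; rewrite gt_eqF.
  rewrite ltr_pdivrMr// mulVf ?gt_eqF// ltrn1 ltnS leqn0 subn_eq0 => nk.
  have -> : k = n by apply/eqP; rewrite eqn_leq kn.
  by rewrite divff ?gt_eqF// /undecided eqxx andbF.
Qed.

(** While the minority is between [r] and [2^-1 - eta], its mean shrinks by a
    constant factor, by an amount that does not depend on [n] whereas the
    fluctuations are of order [1 / sqrt n].  So boundedly many steps lead below
    [r], each of them failing with probability of order [1 / n]. *)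
Lemma minority_shrinks (eta r : R) : 0 < eta < 2^-1 -> 0 < r ->
  exists L, forall eps, 0 < eps -> exists N, forall n (w : R -> R) e y,
    (N <= n)%N -> (0 < n)%N -> 0 <= e ->
    (forall z, grid n z -> 0 <= w z <= 1) ->
    (forall z, grid n z -> minority z <= r -> w z <= e) ->
    grid n y -> minority y <= 2^-1 - eta ->
    iter L (step n f) w y <= e + eps.
Proof.
move=> etah r0; have [k /andP[k0 k1] fk] := update_contract hf etah.
pose k' := (1 + k) / 2.
have k'01 : 0 <= k' < 1 by rewrite /k'; lra.
have k'0 : 0 < k' by rewrite /k'; lra.
have [L kL] := exprn_small k'01 r0.
pose l i := k' ^+ i * (2^-1 - eta).
have l0 i : 0 < l i by rewrite mulr_gt0 ?exprn_gt0//; lra.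
pose s := (k' - k) * l L.
have s0 : 0 < s by rewrite mulr_gt0// /k'; lra.
exists L => eps eps0.
pose B := L%:R / (4 * s ^+ 2 * eps).
exists (Num.truncn B).+1 => n w e y Nn n0 e0 w01 we gy yl.
have nB : B <= n%:R.
  by apply: (@le_trans _ _ (Num.truncn B).+1%:R); [exact/ltW/truncnS_gt|rewrite ler_nat].
have nR : 0 < n%:R :> R by rewrite ltr0n.
apply: le_trans (@iter_step_chain _ n f w (grid n) e L
  (fun i z => minority z <= l i) (fun=> (4 * n%:R * s ^+ 2)^-1) y _ _ _ _ _ _ _ _ _ _) _ => //.
- exact: grid01.
- by move=> i _; exact: chebyshev_ge0.
- move=> i z iL /grid01 z01 zl.
  have xh := minority_itv z01.
  have li : l i <= 2^-1 - eta.
    by rewrite /l ler_piMl//; [lra|apply: exprn_ile1; lra].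
  apply: (step_minority_le hf n0 z01 s0).
  have lL : l L <= l i.
    rewrite /l ler_wpM2r//; first lra.
    by apply: ler_wiXn2l; [lra|lra|exact: ltnW].
  have h : f (minority z) <= k * minority z by apply: fk; lra.
  have -> : l i.+1 = k' * l i by rewrite /l exprS mulrA.
  have h2 : k * minority z <= k * l i by rewrite ler_wpM2l// ltW.
  have h3 : s <= (k' - k) * l i by rewrite ler_wpM2l// /k'; lra.
  lra.
- move=> z gz zl; apply: we => //; apply: (le_trans zl).
  rewrite /l; apply: le_trans kL; rewrite ler_piMr ?exprn_ge0//; lra.
- by rewrite /l expr0 mul1r.
have s20 : 0 < s ^+ 2 by exact: exprn_gt0.
rewrite lerD2l sumr_const card_ord -[leLHS]mulr_natl ler_pdivrMr; last first.
  by rewrite !(s20, mulr_gt0).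
move: nB; rewrite /B ler_pdivrMr; last by rewrite !(s20, mulr_gt0).
by move=> h; apply: (le_trans h); rewrite le_eqVlt; apply/orP; left; apply/eqP; ring.
Qed.

(** The distance to 1/2 grows by the factor [gamma], up to a quadratic error
    and to fluctuations.  The levels [h i = a i + b i - E * a i ^ 2], where
    [a i = K * gamma ^ i / sqrt n] and [b i = K * rho ^ i / sqrt n] with
    [1 < rho < gamma], absorb both: the quadratic error by the last term, and
    the fluctuations by the middle one, with a summable failure probability
    which is small when [K] is large. *)
Lemma imbalance_grows : exists eta E : R, [/\ 0 < eta < 2^-1, 0 < E &
  forall eps, 0 < eps -> exists2 K0, 0 < K0 &
  forall K n T (w : R -> R) e y, K0 <= K -> (0 < n)%N ->
    (2 * gamma)^-1 <= E * K * gamma ^+ T / Num.sqrt n%:R <= 2^-1 -> 0 <= e ->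
    (forall z, grid n z -> 0 <= w z <= 1) ->
    (forall z, grid n z -> minority z <= 2^-1 - eta -> w z <= e) ->
    grid n y -> minority y <= 2^-1 - 2 * K / Num.sqrt n%:R ->
    iter T (step n f) w y <= e + eps].
Proof.
have [C C0 fC] := update_slope_ge hf.
have g1 := majority_gamma_gt1 hf.
pose rho := (1 + gamma) / 2.
have rho1 : 1 < rho by rewrite /rho; lra.
have rhog : rho < gamma by rewrite /rho; lra.
have gg : 0 < gamma ^+ 2 - gamma by rewrite expr2; nra.
pose E := Num.max (4 * C / (gamma ^+ 2 - gamma)) 2.
(* [E >= 2] keeps the levels [h i] below 1/2 *)
have E2 : 2 <= E by rewrite le_max lexx orbT.
have EC : 4 * C <= E * (gamma ^+ 2 - gamma).
  by rewrite -ler_pdivrMr// le_max lexx.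
have E0 : 0 < E by lra.
exists (4 * gamma * E)^-1, E; split=> //.
  have h : 2 < 4 * gamma * E by nra.
  by rewrite invr_gt0 ltf_pV2 ?posrE; lra.
move=> eps eps0.
have rhoV : 0 <= rho ^- 2 < 1.
  rewrite invr_ge0 sqr_ge0/= invf_lt1 ?exprn_gt0//; last by lra.
  by rewrite exprn_egt1.
pose D := (4 * (gamma - rho) ^+ 2)^-1 * (1 - rho ^- 2)^-1.
have D0 : 0 < D by rewrite divr_gt0// ?invr_gt0 ?mulr_gt0 ?exprn_gt0//; lra.
exists (Num.max 1 (D / eps)); first by rewrite lt_max ltr01.
move=> K n T w e y; rewrite ge_max => /andP[K1 KD] n0.
set r := Num.sqrt n%:R => /andP[ET1 ET2] e0 w01 we gy yl.
have nR : 0 < n%:R :> R by rewrite ltr0n.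
have r0 : 0 < r by rewrite sqrtr_gt0.
have rr : r ^+ 2 = n%:R by rewrite sqr_sqrtr// ltW.
have K0 : 0 < K by lra.
pose a i := K * gamma ^+ i / r.
pose b i := K * rho ^+ i / r.
have a0 i : 0 < a i by rewrite !mulr_gt0 ?invr_gt0 ?exprn_gt0//; lra.
have b0 i : 0 < b i by rewrite !mulr_gt0 ?invr_gt0 ?exprn_gt0//; lra.
have ba i : b i <= a i.
  rewrite /a /b ler_pM2r ?invr_gt0// ler_pM2l//.
  by apply: lerXn2r; rewrite ?nnegrE; lra.
have aS i : a i.+1 = gamma * a i by rewrite /a exprS; ring.
have bS i : b i.+1 = rho * b i by rewrite /b exprS; ring.
have aT i : (i <= T)%N -> E * a i <= 2^-1.
  move=> iT; apply: le_trans ET2; rewrite -!mulrA ler_pM2l// /a -mulrA ler_pM2l//.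
  by rewrite ler_pM2r ?invr_gt0// ler_weXn2l//; lra.
have ET1' : (2 * gamma)^-1 <= E * a T by rewrite /a !mulrA.
pose h i := a i + b i - E * a i ^+ 2.
have hB i : (i <= T)%N -> 0 <= h i <= 2^-1 /\ h i <= 2 * a i.
  move=> iT; have := aT i iT; have := a0 i; have := b0 i; have := ba i.
  rewrite /h expr2; set x := a i; set x' := b i => h1 h2 h3 h4.
  have : 0 <= x * (2^-1 - E * x) by rewrite mulr_ge0 ?(ltW h3)//; lra.
  have : 0 <= E * x * x by apply: mulr_ge0; [apply: mulr_ge0 |]; exact: ltW.
  have : 2 * x <= E * x by rewrite ler_wpM2r// ltW.
  move=> u1 u2 u3; split; last by lra.
  by apply/andP; split; lra.
pose s i := (gamma - rho) * b i.
have s0 i : 0 < s i by rewrite mulr_gt0//; lra.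
pose delta i := (4 * n%:R * s i ^+ 2)^-1.
apply: le_trans (@iter_step_chain _ n f w (grid n) e T
  (fun i z => minority z <= 2^-1 - h i) delta y _ _ _ _ _ _ _ _ _ _) _ => //.
- exact: grid01.
- by move=> i _; exact: chebyshev_ge0.
- move=> i z iT /grid01 z01 zl.
  apply: (step_minority_le hf n0 z01 (s0 i)).
  have xh := minority_itv z01.
  have [hi ha] := hB _ (ltnW iT).
  have fm : f (minority z) <= f (2^-1 - h i).
    by apply: (update_mono hf) => //; lra.
  have fh := fC _ hi.
  have h2 : C * h i ^+ 2 <= E * (gamma ^+ 2 - gamma) * a i ^+ 2.
    apply: (@le_trans _ _ (4 * C * a i ^+ 2)); last by rewrite ler_wpM2r// sqr_ge0.
    rewrite [4 * C]mulrC -mulrA ler_pM2l//.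
    have -> : 4 * a i ^+ 2 = (2 * a i) ^+ 2 by ring.
    by apply: lerXn2r; rewrite ?nnegrE//; lra.
  have e1 : gamma * h i - h i.+1 = s i + E * (gamma ^+ 2 - gamma) * a i ^+ 2.
    by rewrite /h aS bS /s; ring.
  lra.
- move=> z gz zl; apply: we => //; apply: (le_trans zl).
  suff : (4 * gamma * E)^-1 <= h T by lra.
  have g0 : 0 < gamma by lra.
  have aTl : (2 * gamma * E)^-1 <= a T.
    by rewrite invfM ler_pdivrMr// [leRHS]mulrC.
  have -> : (4 * gamma * E)^-1 = (2 * gamma * E)^-1 / 2 by field; rewrite !gt_eqF.
  have := aT _ (leqnn T); have := a0 T; have := b0 T; rewrite /h expr2.
  set x := a T in aTl *; set x' := b T => h2 h3 h4.
  have : 0 <= x * (2^-1 - E * x) by rewrite mulr_ge0 ?(ltW h3)//; lra.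
  lra.
- apply: (le_trans yl); rewrite /h /a /b !expr0 !mulr1.
  have : 0 <= E * (K / r) ^+ 2 by rewrite mulr_ge0 ?sqr_ge0// ltW.
  by rewrite -mulrA; lra.
rewrite lerD2l.
have dE i : delta i = (4 * (gamma - rho) ^+ 2)^-1 / K ^+ 2 * (rho ^- 2) ^+ i.
  rewrite /delta /s /b -rr exprVn -exprM mulnC exprM.
  have rhoi : rho ^+ i != 0 by rewrite gt_eqF// exprn_gt0//; lra.
  have gr : gamma - rho != 0 by rewrite gt_eqF//; lra.
  by field; rewrite rhoi gr !gt_eqF.
under eq_bigr => i _ do rewrite dE.
rewrite -mulr_sumr.
apply: (@le_trans _ _ ((4 * (gamma - rho) ^+ 2)^-1 / K ^+ 2 * (1 - rho ^- 2)^-1)).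
  rewrite ler_wpM2l ?sum_geometric_le//.
  by rewrite divr_ge0 ?sqr_ge0// invr_ge0 mulr_ge0// sqr_ge0.
rewrite mulrAC -/D ler_pdivrMr ?exprn_gt0//.
rewrite ler_pdivrMr// in KD; apply: (le_trans KD).
by rewrite mulrC expr2 ler_pM2l// ler_peMl// ltW.
Qed.

End consensus_is_fast.

(** * Consensus is not reached too fast *)

Lemma survival_exponent m i : (2 <= m)%N ->
  (((2 * m ^ i - 1) * m).+1 <= 2 * m ^ i.+1 - 1)%N.
Proof.
move=> m2; have : (0 < m ^ i)%N by rewrite expn_gt0 (ltn_trans _ m2).
rewrite expnS mulnBl mul1n -mulnA [(_ ^ _ * m)%N]mulnC.
by set X := (m ^ i)%N => X0; have := leq_pmulr m X0; lia.
Qed.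

Section consensus_is_not_too_fast.
Context (R : realType) (m : nat) (beta gamma : R) (f : R -> R).
Hypothesis hf : majority_type_update m beta gamma f.

Let fu : unit_map f. Proof. exact: update_unit_map hf. Qed.

Let unitI (z : R) := 0 <= z <= 1.

(** The distance to 1/2 cannot grow faster than by the factor [gamma], which is
    the largest slope of [f].  In the bounds
    [(A * gamma ^ i - B * rho ^ i) / sqrt n], where [1 < rho < gamma], the second
    term leaves room for fluctuations with a summable failure probability. *)
Lemma imbalance_bounded (D0 eps : R) : 0 <= D0 -> 0 < eps -> exists2 A : R, 0 < A &
  forall n T (w : R -> R) e y, (0 < n)%N ->
    A * gamma ^+ T / Num.sqrt n%:R <= 4^-1 -> 0 <= e ->
    (forall z, 0 <= z <= 1 -> 0 <= w z <= 1) ->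
    (forall z, 0 <= z <= 1 -> 4^-1 <= minority z -> w z <= e) ->
    0 <= y <= 1 -> 2^-1 - D0 / Num.sqrt n%:R <= minority y ->
    iter T (step n f) w y <= e + eps.
Proof.
move=> D00 eps0.
have g1 := majority_gamma_gt1 hf.
pose rho := (1 + gamma) / 2.
have rho1 : 1 < rho by rewrite /rho; lra.
have rhog : rho < gamma by rewrite /rho; lra.
have rhoV : 0 <= rho ^- 2 < 1.
  rewrite invr_ge0 sqr_ge0/= invf_lt1 ?exprn_gt0//; last by lra.
  by rewrite exprn_egt1.
pose D := 4^-1 * (1 - rho ^- 2)^-1.
have D_gt0 : 0 < D by rewrite mulr_gt0// invr_gt0; lra.
pose K := Num.max 1 (D / eps).
have K1 : 1 <= K by rewrite le_max lexx.
have KD : D / eps <= K by rewrite le_max lexx orbT.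
have K0 : 0 < K by lra.
pose B := K / (gamma - rho).
have B0 : 0 < B by rewrite divr_gt0//; lra.
have BK : B * (gamma - rho) = K by rewrite /B divfK// gt_eqF//; lra.
pose A := D0 + B.
exists A => [|n T w e y n0]; first by rewrite /A; lra.
set r := Num.sqrt n%:R => AT e0 w01 we y01 yl.
have nR : 0 < n%:R :> R by rewrite ltr0n.
have r0 : 0 < r by rewrite sqrtr_gt0.
have rr : r ^+ 2 = n%:R by rewrite sqr_sqrtr// ltW.
pose a i := (A * gamma ^+ i - B * rho ^+ i) / r.
pose s i := K * rho ^+ i / r.
have rhoi i : 0 < rho ^+ i by apply: exprn_gt0; lra.
have s0 i : 0 < s i by rewrite /s divr_gt0// mulr_gt0.
have aS i : a i.+1 = gamma * a i + s i.
  by rewrite /a /s -BK !exprS; field; rewrite gt_eqF.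
pose delta i := (4 * n%:R * s i ^+ 2)^-1.
apply: le_trans (@iter_step_chain _ n f w unitI e T
  (fun i z => 2^-1 - a i <= minority z) delta y _ _ _ _ _ _ _ _ _ _) _ => //.
- exact: grid01.
- by move=> i _; exact: chebyshev_ge0.
- move=> i z iT z01 zl.
  apply: (step_minority_ge hf n0 z01 (s0 i)).
  have xh := minority_itv z01.
  have := update_slope_le hf (x := 2^-1 - minority z).
  rewrite (_ : 2^-1 - (2^-1 - minority z) = minority z); last by ring.
  move=> sl; have {}sl : 2^-1 - f (minority z) <= gamma * (2^-1 - minority z).
    by apply: sl; lra.
  have : gamma * (2^-1 - minority z) <= gamma * a i by rewrite ler_pM2l; lra.
  rewrite aS; lra.
- move=> z z01 zl; apply: we => //; apply: le_trans zl.
  suff : a T <= 4^-1 by lra.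
  apply: le_trans AT; rewrite /a ler_pM2r ?invr_gt0// gerBl.
  by rewrite ltW// mulr_gt0.
- apply: le_trans yl; rewrite /a !expr0 !mulr1 /A addrK; lra.
rewrite lerD2l.
have dE i : delta i = 4^-1 / K ^+ 2 * (rho ^- 2) ^+ i.
  rewrite /delta /s -rr exprVn -exprM mulnC exprM.
  have rhoi0 : rho ^+ i != 0 by rewrite gt_eqF.
  by field; rewrite rhoi0 !gt_eqF.
under eq_bigr => i _ do rewrite dE.
rewrite -mulr_sumr.
apply: (@le_trans _ _ (4^-1 / K ^+ 2 * (1 - rho ^- 2)^-1)).
  by rewrite ler_wpM2l ?sum_geometric_le// divr_ge0 ?sqr_ge0.
rewrite mulrAC -/D ler_pdivrMr ?exprn_gt0//.
move: (KD); rewrite ler_pdivrMr// => /le_trans; apply.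
by rewrite mulrC expr2 ler_pM2l// ler_peMl// ltW.
Qed.

(** A minority of fraction [y] keeps, up to a constant, a fraction [y ^ m],
    so it stays above the levels [q ^ (2 m ^ i - 1)]; as long as these are above
    [n ^ (-1/4)], Chebyshev's inequality controls all the steps. *)
Lemma minority_survives : exists2 q : R, 0 < q <= 4^-1 &
  forall eps, 0 < eps -> exists N, forall n T y, (N <= n)%N ->
    1 <= q ^+ (8 * m ^ T) * n%:R -> 0 <= y <= 1 -> 4^-1 <= minority y ->
    iter T (step n f) (fun z => 1 - undecided z) y <= eps.
Proof.
have [c /andP[c0 c1] fc] := update_ge_pow hf.
have m2 := majority_m_ge2 hf.
pose q : R := c / 4.
have q0 : 0 < q by rewrite divr_gt0.
have q4 : q <= 4^-1 by rewrite /q; lra.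
exists q; first by rewrite q0.
move=> eps eps0; exists (Num.truncn (eps ^- 2 ^+ 2)).+1 => n T y nN qT y01 yl.
have n0 : (0 < n)%N by exact: leq_trans nN.
have nR : 0 < n%:R :> R by rewrite ltr0n.
pose r : R := Num.sqrt n%:R.
have r0 : 0 < r by rewrite sqrtr_gt0.
have rr : r ^+ 2 = n%:R by rewrite sqr_sqrtr// ltW.
have er : eps ^- 2 <= r.
  have e2 : 0 <= eps ^- 2 by rewrite invr_ge0 sqr_ge0.
  rewrite -(@ler_pXn2r _ 2)// ?nnegrE ?(ltW r0)// rr.
  apply: (@le_trans _ _ (Num.truncn (eps ^- 2 ^+ 2)).+1%:R); last by rewrite ler_nat.
  exact/ltW/truncnS_gt.
pose l i := q ^+ (2 * m ^ i - 1).
have l0 i : 0 < l i by rewrite exprn_gt0.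
have mpos i : (0 < m ^ i)%N by rewrite expn_gt0 (ltn_trans _ m2).
(* [X] is at most [n ^ (1/8)]; it is an upper bound for the number of
   steps, and [X ^- 2] is a lower bound for the levels *)
pose X := q ^- (m ^ T).
have X1 : 1 <= X by rewrite invf_ge1 ?exprn_gt0// exprn_ile1//; lra.
have X0 : 0 < X by lra.
have X4r : X ^+ 4 <= r.
  rewrite -(@ler_pXn2r _ 2)// ?nnegrE ?(ltW r0) ?exprn_ge0 ?(ltW X0)// rr.
  have -> : (X ^+ 4) ^+ 2 = (q ^+ (8 * m ^ T))^-1.
    by rewrite -exprM exprVn -exprM [in RHS]mulnC.
  by rewrite -[leLHS]mul1r ler_pdivrMr ?exprn_gt0// mulrC.
have TX : T%:R <= X.
  apply: (@le_trans _ _ ((m ^ T)%:R)).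
    by rewrite ler_nat ltnW// ltn_expl.
  apply: (@le_trans _ _ ((4 ^ (m ^ T))%:R)).
    by rewrite ler_nat ltnW// ltn_expl.
  rewrite natrX /X -exprVn lerXn2r ?nnegrE ?invr_ge0 ?(ltW q0)//.
  by rewrite -[leLHS]invrK lef_pV2 ?posrE// invr_gt0.
have lX i : (i <= T)%N -> X ^- 2 <= l i.
  move=> iT; rewrite /X exprVn invrK -exprM; apply: ler_wiXn2l; [exact: ltW|lra|].
  rewrite [(m ^ T * 2)%N]mulnC; apply: leq_trans (leq_subr _ _) _.
  by rewrite leq_mul2l leq_exp2l.
pose delta i := (4 * n%:R * l i.+1 ^+ 2)^-1.
apply: le_trans (@iter_step_chain _ n f (fun z => 1 - undecided z) unitI 0 T
  (fun i z => l i <= minority z) delta y _ _ _ _ _ _ _ _ _ _) _ => //.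
- exact: grid01.
- by move=> z _; have := undecided01 z; lra.
- by move=> i _; exact: chebyshev_ge0.
- move=> i z iT z01 zl; apply: (step_minority_ge hf n0 z01 (l0 i.+1)).
  have xh := minority_itv z01.
  apply: le_trans (fc _ xh).
  apply: (@le_trans _ _ (c * l i ^+ m)); last first.
    rewrite ler_pM2l//; apply: lerXn2r; rewrite ?nnegrE ?(ltW (l0 _))//.
    by case/andP: xh.
  have : l i.+1 <= q * l i ^+ m.
    rewrite /l -exprM -exprS; apply: ler_wiXn2l; [exact: ltW|lra|].
    exact: survival_exponent.
  have : 0 < c * l i ^+ m by apply: mulr_gt0 => //; exact: exprn_gt0.
  by rewrite /q; move: (l i ^+ m) (l i.+1) => u v; lra.
- move=> z z01 zl; have z0 : 0 < minority z by exact: lt_le_trans zl.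
  move: z0; rewrite lt_minority => /andP[z0 z1].
  rewrite /undecided gt_eqF// lt_eqF; last by lra.
  by rewrite subrr.
- rewrite /l expn0 muln1 subSS subn0 expr1; lra.
rewrite add0r.
apply: (@le_trans _ _ (X / (4 * r))).
  apply: (@le_trans _ _ (\sum_(i < T) (4 * r)^-1)).
    apply: ler_sum => i _; rewrite /delta lef_pV2; last 2 first.
    - by rewrite posrE; apply: mulr_gt0; [apply: mulr_gt0|exact: exprn_gt0].
    - by rewrite posrE mulr_gt0.
    rewrite -rr -mulrA ler_pM2l// expr2 -mulrA ler_peMr ?(ltW r0)//.
    have h := lX i.+1 (ltn_ord i).
    apply: (@le_trans _ _ (X ^+ 4 * (X ^- 2) ^+ 2)).
      by rewrite exprVn -exprM mulfV// gt_eqF// exprn_gt0.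
    apply: ler_pM => //; first by rewrite exprn_ge0// ltW.
      by rewrite sqr_ge0.
    apply: lerXn2r => //; first by rewrite nnegrE invr_ge0 sqr_ge0.
    by rewrite nnegrE ltW.
  rewrite sumr_const card_ord -[leLHS]mulr_natl ler_wpM2r// invr_ge0.
  by rewrite mulr_ge0// ltW.
rewrite ler_pdivrMr ?mulr_gt0//.
have Xr : X ^+ 2 <= (eps * r) ^+ 2.
  apply: (@le_trans _ _ r).
    by apply: le_trans X4r; rewrite ler_weXn2l.
  rewrite exprMn expr2 [r ^+ 2]expr2 mulrA ler_peMl ?(ltW r0)//.
  by move: er; rewrite -[_ ^- 2]mul1r ler_pdivrMr ?exprn_gt0// mulrC.
rewrite ler_pXn2r// ?nnegrE ?mulr_ge0 ?(ltW X0) ?(ltW eps0) ?(ltW r0)// in Xr.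
apply: (le_trans Xr).
have : 0 <= eps * r by rewrite mulr_ge0 ?ltW.
lra.
Qed.

End consensus_is_not_too_fast.

(** * Assembling the phases *)

(** The number of steps after which a geometric sequence of ratio [b] reaches the
    scale [x / c] is the logarithm of [x], up to a constant which does not depend
    on [x]. *)
Lemma exprn_log_time (R : realType) (b c : R) : 1 < b -> 0 < c ->
  exists C : R, forall x, c <= x -> exists T : nat,
    [/\ b ^+ T <= x / c, x / c < b ^+ T.+1 & `|T%:R - logb b x| <= C].
Proof.
move=> b1 c0; have b0 : 0 < b by lra.
have lnb : 0 < ln b by rewrite ln_gt0.
exists (`|logb b c| + 1) => x cx.
have x0 : 0 < x by exact: lt_le_trans cx.
have z1 : 1 <= x / c by rewrite ler_pdivlMr// mul1r.
have z0 : 0 < x / c by rewrite divr_gt0.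
have lE : logb b (x / c) = logb b x - logb b c.
  by rewrite /logb ln_div ?posrE// mulrBl.
have l0 : 0 <= logb b (x / c) by rewrite divr_ge0 ?ln_ge0// ltW.
exists (Num.truncn (logb b (x / c))).
have /andP[t1 t2] := truncn_itv l0.
set T := Num.truncn _ in t1 t2 *.
split.
- rewrite -ler_ln ?posrE ?exprn_gt0// lnXn// -[leLHS]mulr_natl.
  by rewrite -ler_pdivlMr.
- rewrite -ltr_ln ?posrE ?exprn_gt0// lnXn// -[ltRHS]mulr_natl.
  by rewrite -ltr_pdivrMr.
rewrite ler_norml; have := ler_norm (logb b c); have := ler_norm (- logb b c).
rewrite normrN => h1 h2; rewrite lE in t1 t2.
by move: t2; rewrite -natr1; lra.
Qed.

Lemma near_sqrt_ge (R : realType) (c : R) :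
  exists N, forall n, (N <= n)%N -> c <= Num.sqrt n%:R.
Proof.
exists (Num.truncn (c ^+ 2)).+1 => n Nn; apply: (le_trans (ler_norm _)).
rewrite -sqrtr_sqr ler_sqrt//; apply: (@le_trans _ _ (Num.truncn (c ^+ 2)).+1%:R).
  exact/ltW/truncnS_gt.
by rewrite ler_nat.
Qed.

Lemma near_ln_ge (R : realType) (c : R) :
  exists N, forall n, (N <= n)%N -> c <= ln n%:R.
Proof.
exists (Num.truncn (expR c)).+1 => n Nn; rewrite -[c]expRK.
rewrite ler_ln ?posrE ?expR_gt0 ?ltr0n//; last exact: leq_trans Nn.
apply: (@le_trans _ _ (Num.truncn (expR c)).+1%:R); last by rewrite ler_nat.
exact/ltW/truncnS_gt.
Qed.

Section two_sided_bounds.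
Context (R : realType) (m : nat) (beta gamma : R) (f : R -> R).
Hypothesis hf : majority_type_update m beta gamma f.

Let fu : unit_map f. Proof. exact: update_unit_map hf. Qed.

Let expected (n : nat) : R := 2^-1 * logb gamma n%:R + logb m%:R (ln n%:R).

Let logb_sqrt n : (0 < n)%N ->
  logb gamma (Num.sqrt n%:R) = 2^-1 * logb gamma n%:R.
Proof.
move=> n0; have nR : 0 < n%:R :> R by rewrite ltr0n.
have r0 : 0 < Num.sqrt n%:R :> R by rewrite sqrtr_gt0.
have -> : logb gamma n%:R = logb gamma (Num.sqrt n%:R) + logb gamma (Num.sqrt n%:R).
  by rewrite /logb -mulrDl -lnM ?posrE// -expr2 sqr_sqrtr// ltW.
lra.
Qed.

Let m1 : 1 < m%:R :> R.
Proof. by rewrite ltr1n; exact: majority_m_ge2 hf. Qed.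

(** Climb out of the central region, growth of the imbalance, contraction of
    the minority, and endgame, each failing with probability at most a quarter
    of [eps]. *)
Lemma consensus_upper_bound (eps : R) : 0 < eps -> exists (C : R) N,
  forall n, (N <= n)%N -> exists2 t : nat, t%:R <= expected n + C &
    forall y, grid n y -> iter t (step n f) (@undecided R) y <= eps.
Proof.
move=> eps0; have e0 : 0 < eps / 4 by rewrite divr_gt0.
have g1 := majority_gamma_gt1 hf.
have [q /andP[q0 qh] end_] := endgame hf e0.
have [eta [E [etah E0 /(_ _ e0)[K0 K00 grow]]]] := imbalance_grows hf.
have q3 : 0 < q ^+ 3 by rewrite exprn_gt0.
have [Ls /(_ _ e0)[N1 shrink]] := minority_shrinks hf etah q3.
pose L := (Num.truncn (40 * K0)).+1.
(* [L] fluctuations of size [20^-1 * sqrt n] give an imbalance [2 * K * sqrt n] *)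
pose K : R := L%:R / 40.
have LR : 0 < L%:R :> R by rewrite ltr0n.
have K0K : K0 <= K.
  by rewrite /K ler_pdivlMr// mulrC; exact/ltW/truncnS_gt.
have K_gt0 : 0 < K by lra.
have c01 : 0 <= 1 - (48^-1 : R) ^+ L < 1.
  have h : 0 < (48^-1 : R) ^+ L by rewrite exprn_gt0// invr_gt0.
  have : (48^-1 : R) ^+ L <= 1 by rewrite exprn_ile1//; lra.
  lra.
have [j hj] := exprn_small c01 e0.
have EK : 0 < 2 * E * K by rewrite !mulr_gt0.
have [C1 time1] := exprn_log_time g1 EK.
have lnq : 0 < - ln q by rewrite oppr_gt0 ln_lt0//; lra.
have [C2 time2] := exprn_log_time m1 lnq.
have [N2 hN2] := near_sqrt_ge (2 * E * K).
have [N3 hN3] := near_ln_ge (- ln q).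
have [N4 hN4] := near_sqrt_ge (gamma * L%:R / 5).
exists ((j * L)%N%:R + Ls%:R + C1 + C2 + 1),
  (maxn 4 (maxn N1 (maxn N2 (maxn N3 N4)))) => n.
rewrite !geq_max => /and5P[n4 nN1 nN2 nN3 nN4].
have n0 : (0 < n)%N by exact: leq_trans n4.
have nR : 0 < n%:R :> R by rewrite ltr0n.
have r0 : 0 < Num.sqrt n%:R :> R by rewrite sqrtr_gt0.
have [|T1 [T1a T1b T1c]] := time1 (Num.sqrt n%:R); first exact: hN2.
have [|T2 [T2a T2b T2c]] := time2 (ln n%:R); first exact: hN3.
exists (j * L + (T1 + (Ls + T2.+1)))%N.
  have -> : (j * L + (T1 + (Ls + T2.+1)))%:R =
      (j * L)%:R + (T1%:R + (Ls%:R + (T2%:R + 1))) :> R by rewrite natr1 -!natrD.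
  by move: T1c T2c; rewrite !ler_norml logb_sqrt// /expected; lra.
have und01 (z : R) : grid n z -> 0 <= undecided z <= 1 by move=> _; exact: undecided01.
have bnd t z : grid n z -> 0 <= iter t (step n f) (@undecided R) z <= 1.
  move=> gz; apply: (@iter_step_bounded _ _ _ _ _ _ (grid n)) => //.
  exact: grid01.
have last_phase z : grid n z -> minority z <= q ^+ 3 ->
    iter T2.+1 (step n f) (@undecided R) z <= eps / 4.
  apply: end_ => //.
  rewrite -ler_ln ?posrE ?mulr_gt0 ?exprn_gt0// ln1 lnM ?posrE ?exprn_gt0//.
  rewrite lnXn// -[ln q *+ _]mulr_natl natrX.
  by move: T2b; rewrite ltr_pdivrMr//; lra.
have second_phase z : grid n z -> minority z <= 2^-1 - eta ->
    iter (Ls + T2.+1) (step n f) (@undecided R) z <= eps / 4 + eps / 4.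
  move=> gz ze; rewrite iterD; apply: shrink => //; [exact: ltW | exact: bnd].
have first_phase z : grid n z -> minority z <= 2^-1 - 2 * K / Num.sqrt n%:R ->
    iter (T1 + (Ls + T2.+1)) (step n f) (@undecided R) z
    <= eps / 4 + eps / 4 + eps / 4.
  move=> gz zK; rewrite iterD; apply: (grow K n) => //; [|lra|exact: bnd].
  have g0 : 0 < gamma by lra.
  apply/andP; split.
    rewrite ler_pdivlMr// ler_pdivrMl ?mulr_gt0//.
    by move: T1b; rewrite ltr_pdivrMr// exprS; lra.
  rewrite ler_pdivrMr//.
  by move: T1a; rewrite ler_pdivlMr//; lra.
move=> y gy.
have c48 : 0 <= (48^-1 : R) <= 1 by lra.
have e3 : 0 <= eps / 4 + eps / 4 + eps / 4 by lra.
pose A i (z : R) := minority z <= 2^-1 - i%:R * (20^-1 / Num.sqrt n%:R).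
have climb := @iter_step_climb R n f (@undecided R) A L (T1 + (Ls + T2.+1)) _ _ j y
  fu und01 _ c48 e3 _ _ _ gy.
apply: le_trans (climb _ _ _ _) _.
- move=> z /grid01 z01; exact: step_undecided_decr hf _ n0 z01.
- by move=> z /grid01/minority_itv zh; rewrite /A mul0r subr0; case/andP: zh.
- move=> i z iL /grid01 z01 Az; rewrite /A -ltNge => nAz.
  have xh := minority_itv z01.
  have zl : 2^-1 - minority z <= L%:R * (20^-1 / Num.sqrt n%:R).
    have : (i.+1)%:R * (20^-1 / Num.sqrt n%:R) <= L%:R * (20^-1 / Num.sqrt n%:R) :> R.
      by rewrite ler_wpM2r ?ler_nat// divr_ge0.
    lra.
  have sl : gamma * (L%:R * (20^-1 / Num.sqrt n%:R)) <= 4^-1.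
    have := hN4 n nN4; set r := Num.sqrt n%:R => h.
    have -> : gamma * (L%:R * (20^-1 / r)) = gamma * L%:R / 5 / r / 4.
      by field; rewrite gt_eqF.
    suff : gamma * L%:R / 5 / r <= 1 by lra.
    by rewrite ler_pdivrMr// mul1r.
  have fz : 4^-1 <= f (minority z).
    have := update_slope_le hf (x := 2^-1 - minority z).
    rewrite (_ : 2^-1 - (2^-1 - minority z) = minority z); last by ring.
    move=> s2; have {}s2 : 2^-1 - f (minority z) <= gamma * (2^-1 - minority z).
      by apply: s2; lra.
    have : gamma * (2^-1 - minority z) <= gamma * (L%:R * (20^-1 / Num.sqrt n%:R)).
      by rewrite ler_pM2l//; lra.
    lra.
  apply: le_trans (step_minority_fluctuation hf n0 n4 z01 fz) _.
  apply: step_le => // z' _; rewrite ler_nat.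
  case: (boolP (minority z' <= _ - _)) => // zs.
  suff -> : minority z' <= 2^-1 - i.+1%:R * (20^-1 / Num.sqrt n%:R) by [].
  have iS : i.+1%:R = i%:R + 1 :> R by rewrite natr1.
  by move: Az zs; rewrite /A iS mulrDl mul1r; lra.
- move=> z gz Az; apply: first_phase => //; apply: (le_trans Az).
  by rewrite /K le_eqVlt; apply/orP; left; apply/eqP; field; rewrite gt_eqF.
lra.
Qed.

(** An imbalance of order [sqrt n] first has to become a fraction of [n], and
    then the minority, still at least a quarter of [n], has to disappear. *)
Lemma consensus_lower_bound (D0 eps : R) : 0 <= D0 -> 0 < eps -> exists (C : R) N,
  forall n, (N <= n)%N -> exists2 t : nat, expected n - C <= t%:R &
    forall y, 0 <= y <= 1 -> 2^-1 - D0 / Num.sqrt n%:R <= minority y ->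
      iter t (step n f) (fun z => 1 - undecided z) y <= eps.
Proof.
move=> D00 eps0; have e0 : 0 < eps / 2 by rewrite divr_gt0.
have g1 := majority_gamma_gt1 hf.
have [A A0 grow] := imbalance_bounded hf D00 e0.
have [q /andP[q0 qh] /(_ _ e0)[N1 survive]] := minority_survives hf.
have A4 : 0 < 4 * A by rewrite mulr_gt0.
have [C1 time1] := exprn_log_time g1 A4.
have lnq : 0 < - (8 * ln q) by rewrite oppr_gt0 pmulr_rlt0// ln_lt0//; lra.
have [C2 time2] := exprn_log_time m1 lnq.
have [N2 hN2] := near_sqrt_ge (4 * A).
have [N3 hN3] := near_ln_ge (- (8 * ln q)).
exists (C1 + C2), (maxn 1 (maxn N1 (maxn N2 N3))) => n.
rewrite !geq_max => /and4P[n0 nN1 nN2 nN3].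
have nR : 0 < n%:R :> R by rewrite ltr0n.
have r0 : 0 < Num.sqrt n%:R :> R by rewrite sqrtr_gt0.
have [|T1 [T1a T1b T1c]] := time1 (Num.sqrt n%:R); first exact: hN2.
have [|T2 [T2a T2b T2c]] := time2 (ln n%:R); first exact: hN3.
exists (T1 + T2)%N.
  have -> : (T1 + T2)%:R = T1%:R + T2%:R :> R by rewrite natrD.
  by move: T1c T2c; rewrite !ler_norml logb_sqrt// /expected; lra.
move=> y y01 yD; rewrite iterD [eps]splitr; apply: grow => //.
- rewrite ler_pdivrMr//.
  by move: T1a; rewrite ler_pdivlMr//; lra.
- by lra.
- move=> z z01.
  apply: (@iter_step_bounded _ _ _ _ _ _ (fun z => 0 <= z <= 1)) => //.
    exact: grid01.
  by move=> z' _; have := undecided01 z'; lra.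
- move=> z z01 z4; apply: survive => //.
  rewrite -ler_ln ?posrE ?mulr_gt0 ?exprn_gt0// ln1 lnM ?posrE ?exprn_gt0//.
  rewrite lnXn// -[ln q *+ _]mulr_natl natrM natrX.
  by move: T2a; rewrite ler_pdivlMr//; lra.
Qed.

End two_sided_bounds.

(** * From the transition operator to the process *)

Lemma iter_step_compl (R : realType) n (f g : R -> R) t y :
  iter t (step n f) (fun z => 1 - g z) y = 1 - iter t (step n f) g y.
Proof.
elim: t y => [//|t IH] y /=; rewrite (eq_step f y (fun z _ => IH z)).
rewrite /step bin_meanD bin_meanC -mulN1r -bin_meanZ.
by under [in RHS]eq_bin_mean do rewrite mulN1r.
Qed.

Section process.
Context (R : realType) (disp : measure_display) (T : measurableType disp).
Context (P : probability T R) (n : nat) (f : R -> R) (x0 : R).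
Context (X : nat -> {RV P >-> R}).
Hypothesis n0 : (0 < n)%N.
Hypothesis fu : unit_map f.
Hypothesis undecided_decr : forall y : R, 0 <= y <= 1 ->
  step n f (@undecided R) y <= undecided y.
Hypothesis hX : opinion_process n f x0 X.

Definition hit (t : nat) : set T :=
  [set w | X t w = n%:R \/ n%:R - X t w = n%:R].

Definition undecided_during (t r : nat) : set T :=
  [set w | forall i, (t <= i <= t + r)%N -> ~ hit i w].

Let past (t : nat) (x : nat -> R) : set T :=
  [set w | forall i, (i <= t)%N -> X i w = x i].

Let measurable_eq t (c : R) : measurable [set w | X t w = c].
Proof. exact: (measurable_funPTI (X t) (measurable_set1 c)). Qed.

Let measurable_past t x : measurable (past t x).
Proof.
have -> : past t x = \bigcap_(i in `I_t.+1) [set w | X i w = x i].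
  by apply/seteqP; split=> w /= h i; [move=> /= it; exact: h|move=> it; exact: h].
by apply: bigcap_measurable => [|i _]; [exists 0%N|exact: measurable_eq].
Qed.

Lemma measurable_hit t : measurable (hit t).
Proof.
have -> : hit t = [set w | X t w = n%:R] `|` [set w | X t w = 0].
  apply/seteqP; split=> w [h|h]; [by left| |by left|].
    by right => /=; lra.
  by right; rewrite /= in h *; lra.
by apply: measurableU; exact: measurable_eq.
Qed.

Lemma measurable_undecided_during t r : measurable (undecided_during t r).
Proof.
have -> : undecided_during t r =
    \bigcap_(i in [set i | (t <= i <= t + r)%N]) ~` hit i.
  by apply/seteqP; split.
apply: bigcap_measurable => [|i _]; last exact/measurableC/measurable_hit.
by exists t; rewrite /= leqnn leq_addr.
Qed.

(** The states that carry the whole mass of an event carry that of its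
    sub-events. *)
Let measure_partition (A B : set T) (E : nat -> set T) N :
  measurable A -> measurable B -> (forall k, measurable (E k)) ->
  trivIset setT E -> B `<=` A ->
  (\sum_(k < N) P (A `&` E k) = P A)%E ->
  (P B = \sum_(k < N) P (B `&` E k))%E.
Proof.
move=> mA mB mE tE BA sumA.
have mU : measurable (\big[setU/set0]_(k < N) E k) by exact: bigsetU_measurable.
have sumE C : measurable C ->
    (P (C `&` \big[setU/set0]_(k < N) E k) = \sum_(k < N) P (C `&` E k))%E.
  move=> mC; rewrite big_distrr/=.
  rewrite (@measure_semi_additive_ord_I _ _ _ _ (fun k => C `&` E k))//.
  - by move=> k _; exact: measurableI.
  - apply: (sub_trivIset (D' := setT)) => //.
    by apply/trivIsetP => i j _ _ ij; rewrite setIACA (trivIsetP.1 tE)// setI0.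
  - by apply: bigsetU_measurable => k _; exact: measurableI.
have null : P (B `\` \big[setU/set0]_(k < N) E k) = 0%E.
  apply/eqP; rewrite eq_le measure_ge0 andbT.
  apply: (@le_trans _ _ (P (A `\` \big[setU/set0]_(k < N) E k))).
    apply: le_measure; rewrite ?inE; try exact: measurableD.
    exact: setSD.
  rewrite measureD//; last by rewrite ltey_eq fin_num_measure.
  by rewrite [X in (_ - X)%E]sumE// sumA subee// fin_num_measure.
by rewrite -(sumE _ mB) [LHS](measureDI P mB mU) [X in (X + _)%E]null add0e.
Qed.

Let hitP t w : hit t w <-> undecided (X t w / n%:R) = 0.
Proof.
have nR : n%:R != 0 :> R by rewrite pnatr_eq0 -lt0n.
have dE (u v : R) : (u / n%:R == v) = (u == v * n%:R).
  by rewrite -subr_eq0 -(inj_eq (mulIf nR)) mulrBl divfK// mul0r subr_eq0.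
rewrite /undecided !dE mul0r mul1r; split=> [|/eqP].
  case=> h; first by rewrite h eqxx andbF.
  have -> : X t w = 0 by lra.
  by rewrite eqxx.
rewrite pnatr_eq0 eqb0 negb_and !negbK => /orP[]/eqP h; last by left.
by right; rewrite h subr0.
Qed.

Let iter_undecided_absorbed r y : grid n y -> undecided y = 0 ->
  iter r (step n f) (@undecided R) y = 0.
Proof.
move=> gy y0; apply/eqP; rewrite eq_le; apply/andP; split.
  rewrite -[leRHS]y0 -[r]addn0; apply: (@iter_step_nonincr _ _ _ _ r 0) => //.
  by move=> z /grid01; exact: undecided_decr.
by have /andP[] := iter_step_bounded r fu (@grid01 R n) (fun z h => h)
  (fun z _ => undecided01 z) gy.
Qed.

(** By induction on the number [r] of rounds ahead: the event is split according
    to the state in round [t + 1], which is added to the past. *)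
Lemma probability_undecided_past r t (x : nat -> R) : 0 <= x t <= n%:R ->
  (P (past t x `&` undecided_during t r) =
   P (past t x) * (iter r (step n f) (@undecided R) (x t / n%:R))%:E)%E.
Proof.
have nR : 0 < n%:R :> R by rewrite ltr0n.
have now s r' : (s <= s <= s + r')%N by rewrite leqnn leq_addr.
elim: r t x => [|r IH] t x xt; have [xt0|xt0] := eqVneq (undecided (x t / n%:R)) 0.
- rewrite /= xt0 mule0 (_ : _ `&` _ = set0) ?measure0// -subset0.
  by move=> w [pw /(_ t (now _ _))]; apply; apply/hitP; rewrite pw.
- have DD : undecided (x t / n%:R) = 1.
    by move: xt0; rewrite /undecided; case: (_ && _) => //; rewrite eqxx.
  rewrite /= DD mule1 (_ : _ `&` _ = past t x)//; apply/seteqP; split=> [w []//|w pw].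
  split=> // i; rewrite addn0 -eqn_leq => /eqP <- /hitP.
  by rewrite pw// => /eqP; rewrite (negbTE xt0).
- rewrite iter_undecided_absorbed ?mule0//; last first.
    move/eqP: xt0; rewrite /undecided pnatr_eq0 eqb0 negb_and !negbK.
    case/orP=> /eqP ->; first by exists 0%N => //; rewrite mul0r.
    by exists n => //; rewrite divff// gt_eqF.
  rewrite (_ : _ `&` _ = set0) ?measure0// -subset0.
  by move=> w [pw /(_ t (now _ _))]; apply; apply/hitP; rewrite pw.
pose E k := [set w | X t.+1 w = k%:R].
pose x' k i := if i == t.+1 then k%:R else x i.
have x'S k : x' k t.+1 = k%:R by rewrite /x' eqxx.
have pastE k : past t x `&` E k = past t.+1 (x' k).
  apply/seteqP; split=> w.
    case=> pw Ek i; rewrite leq_eqVlt /x' => /predU1P[->|]; first by rewrite eqxx.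
    by rewrite ltnS => it; rewrite ltn_eqF ?ltnS//; exact: pw.
  move=> pw; split; last by rewrite /E /= pw// x'S.
  by move=> i it; rewrite pw ?(leqW it)// /x' ltn_eqF// ltnS.
have pastP k : (P (past t.+1 (x' k)) =
    P (past t x) * (binomial_pmf n (f (x t / n%:R)) k)%:E)%E.
  by rewrite -pastE; exact: hX.2.
have pfin : P (past t x) \is a fin_num by rewrite fin_num_measure.
rewrite (@measure_partition (past t x) _ E n.+1); last 6 first.
- exact: measurable_past.
- by apply: measurableI => //; exact: measurable_undecided_during.
- by move=> k; exact: measurable_eq.
- apply/trivIsetP => i j _ _ ij; rewrite -subset0 => w [Ei Ej].
  have {}Ei : X t.+1 w = i%:R := Ei; have {}Ej : X t.+1 w = j%:R := Ej.
  by move: ij; rewrite -(eqr_nat R) -Ei -Ej eqxx.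
- by move=> w [].
- under eq_bigr => k _ do rewrite pastE pastP.
  rewrite -(fineK pfin); under eq_bigr => k _ do rewrite -EFinM.
  rewrite sumEFin -mulr_sumr (_ : \sum_(k < _) _ = 1) ?mulr1//.
  rewrite -[RHS](bin_meanC n (f (x t / n%:R))).
  by apply: eq_bigr => k _; rewrite mulr1.
transitivity (\sum_(k < n.+1) P (past t x) * (binomial_pmf n (f (x t / n%:R)) k *
    iter r (step n f) (@undecided R) (k%:R / n%:R))%:E)%E; last first.
  rewrite -(fineK pfin); under eq_bigr => k _ do rewrite -EFinM.
  by rewrite sumEFin -mulr_sumr -EFinM.
apply: eq_bigr => k _.
have -> : past t x `&` undecided_during t r.+1 `&` E k =
    past t.+1 (x' k) `&` undecided_during t.+1 r.
  rewrite -pastE setIAC; apply/seteqP; split=> w [pw uw]; split=> // i.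
    by move=> /andP[ti ir]; apply: uw; rewrite (ltnW ti) -addSnnS.
  rewrite leq_eqVlt -addSnnS => /andP[/predU1P[<- _|ti ir]]; last first.
    by apply: uw; rewrite ti.
  by move=> /hitP; case: pw => pw _; rewrite pw// => /eqP; rewrite (negbTE xt0).
rewrite IH; last first.
  by rewrite x'S ler0n ler_nat -ltnS ltn_ord.
by rewrite pastP x'S EFinM muleA.
Qed.

Hypothesis x0n : 0 <= x0 <= n%:R.

Lemma probability_undecided r : 
  P (undecided_during 0 r) = (iter r (step n f) (@undecided R) (x0 / n%:R))%:E.
Proof.
have := @probability_undecided_past r 0 (fun=> x0) x0n.
have -> : past 0 (fun=> x0) = setT.
  by apply/seteqP; split=> // w _ i; rewrite leqn0 => /eqP ->; exact: hX.1.
by rewrite setTI probability_setT mul1e.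
Qed.

Let first_hit t : set T := hit t `&` [set w | forall s, (s < t)%N -> ~ hit s w].

Let never_hit : set T := [set w | forall t, ~ hit t w].

Let measurable_first_hit t : measurable (first_hit t).
Proof.
apply: measurableI; first exact: measurable_hit.
rewrite (_ : [set w | _] = \bigcap_(s in [set s | (s < t)%N]) ~` hit s); last first.
  by apply/seteqP; split.
have [->|t0] := posnP t.
  by rewrite (_ : [set s | _] = set0) ?bigcap_set0//; apply/seteqP; split.
apply: bigcap_measurable => [|s _]; last exact/measurableC/measurable_hit.
by exists 0%N.
Qed.

Let measurable_never_hit : measurable never_hit.
Proof.
rewrite (_ : never_hit = \bigcap_t ~` hit t); last first.
  by apply/seteqP; split=> w h t; [move=> _; exact: h|exact: (h t I)].
by apply: bigcapT_measurable => t; exact/measurableC/measurable_hit.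
Qed.

Let hit_cases w : never_hit w \/ exists t, first_hit t w.
Proof.
have [h|h] := pselect (exists t, hit t w); last by left=> t ht; apply: h; exists t.
right; have h' : exists t, `[< hit t w >] by case: h => t ht; exists t; apply/asboolP.
have [t /asboolP ht tmin] := ex_minnP h'; exists t; split=> // s st hs.
by have /asboolP/tmin := hs; rewrite leqNgt st.
Qed.

Let tau (w : T) : \bar R := runtime n (fun t => X t) w.

Let tau_first t w : first_hit t w -> tau w = (t%:R)%:E.
Proof.
move=> [ht hmin]; apply/eqP; rewrite eq_le; apply/andP; split.
  by apply: ereal_inf_lbound; exists t.
apply: le_ereal_inf_tmp => _ [s hs <-]; rewrite lee_fin ler_nat leqNgt.
by apply/negP => st; exact: hmin st hs.
Qed.

Let tau_never w : never_hit w -> tau w = +oo%E.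
Proof.
move=> nh; rewrite /tau /runtime.
have -> : [set t : nat | X t w = n%:R \/ n%:R - X t w = n%:R] = set0.
  by rewrite -subset0 => t; exact: nh.
by rewrite image_set0 ereal_inf0.
Qed.

(** The event is a countable union over the values of the runtime, hence
    measurable; on it the runtime is either larger than [tu] or at most [tl]. *)
Lemma probability_runtime_far (C a : R) tl tu :
  0 <= C -> tu%:R < a + C -> a - C < tl%:R ->
  (P [set w | C%:E <= `|tau w - a%:E|] <=
   P (undecided_during 0 tu) + (1 - P (undecided_during 0 tl)))%E.
Proof.
move=> C0 tuC tlC.
set S := [set w | _].
have SE : S = (\bigcup_(t in [set t | C <= `|t%:R - a|]) first_hit t) `|` never_hit.
  apply/seteqP; split=> w.
    move=> Sw; have [|[t ft]] := hit_cases w; first by right.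
    by left; exists t => //; move: Sw; rewrite /S /= (tau_first ft) lee_fin.
  case=> [[t /= Ct ft]|nw]; rewrite /S /=; first by rewrite (tau_first ft) lee_fin.
  by rewrite (tau_never nw) leey.
have mS : measurable S.
  rewrite SE; apply: measurableU => //.
  by apply: bigcup_measurable => t _; exact: measurable_first_hit.
have mtl := measurable_undecided_during 0 tl.
have mtu := measurable_undecided_during 0 tu.
rewrite -probability_setC//.
apply: (@le_trans _ _ (P (undecided_during 0 tu `|` ~` undecided_during 0 tl))).
  apply: le_measure; rewrite ?inE//.
    by apply: measurableU => //; exact: measurableC.
  move=> w Sw; have := hit_cases w; move: Sw; rewrite /S /=.
  move=> Cw [nw|[t ft]]; first by left => i _; exact: nw.
  move: Cw; rewrite (tau_first ft) lee_fin ler_normr => /orP[] h.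
    left => i /andP[_ itu]; apply: ft.2.
    by rewrite -(ltr_nat R); apply: (@le_lt_trans _ _ tu%:R); [rewrite ler_nat|lra].
  right => /(_ t) H; apply: (H _ ft.1); rewrite leq0n/= add0n.
  by rewrite -(ler_nat R); lra.
by apply: measureU2 => //; exact: measurableC.
Qed.

End process.

(** * Runtime of the majority-type dynamics *)

Theorem corollary1p4 (R : realType) (d : R) (m : nat) (beta gamma : R)
    (f : R -> R) (hf : majority_type_update m beta gamma f)
    (x0 : nat -> R) (hx0 : forall n, 0 <= x0 n <= n%:R)
    (hx0d : (fun n => x0 n - (n%:R / 2 + d * Num.sqrt n%:R))
              =o_\oo (fun n => Num.sqrt (n%:R : R)))
    (disp : nat -> measure_display) (T : forall n, measurableType (disp n))
    (P : forall n, probability (T n) R)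
    (X : forall n, nat -> {RV (P n) >-> R})
    (hX : forall n, (0 < n)%N -> opinion_process n f (x0 n) (X n)) :
  bounded_in_probability P (fun n w =>
    (runtime n (fun t => X n t) w
     - (2^-1 * logb gamma n%:R + logb m%:R (ln n%:R))%:E)%E).
Proof.
move=> eps eps0; have e2 : 0 < eps / 2 by rewrite divr_gt0.
have D0 : 0 <= `|d| + 1 by rewrite addr_ge0.
have [Cu [Nu upper]] := consensus_upper_bound hf e2.
have [Cl [Nl lower]] := consensus_lower_bound hf D0 e2.
have [N0 close] : exists N0, forall n, (N0 <= n)%N ->
    `|x0 n - (n%:R / 2 + d * Num.sqrt n%:R)| <= Num.sqrt n%:R.
  have /eqoP/(_ 1 ltr01)[N0 _ H] := hx0d; exists N0 => n Nn.
  by have := H n Nn; rewrite mul1r [`|Num.sqrt _|]ger0_norm.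
exists (`|Cu| + `|Cl| + 2), (maxn 1 (maxn Nu (maxn Nl N0))) => n.
rewrite !geq_max => /and4P[n0 nu nl nN0].
have nR : 0 < n%:R :> R by rewrite ltr0n.
have r0 : 0 < Num.sqrt n%:R :> R by rewrite sqrtr_gt0.
have rr : Num.sqrt n%:R ^+ 2 = n%:R :> R by rewrite sqr_sqrtr// ltW.
have fu := update_unit_map hf.
have [tu tuC upper_t] := upper n nu.
have [tl tlC lower_t] := lower n nl.
have decr (y : R) : 0 <= y <= 1 -> step n f (@undecided R) y <= undecided y.
  exact: step_undecided_decr hf _ n0.
set a := _ + logb _ _ in tuC tlC *.
have y01 : 0 <= x0 n / n%:R <= 1.
  have /andP[h1 h2] := hx0 n.
  by rewrite divr_ge0//= ler_pdivrMr// mul1r.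
have Cu_le := ler_norm Cu; have Cl_le := ler_norm Cl.
apply: (le_trans (@probability_runtime_far R _ _ (P n) n (X n)
  (`|Cu| + `|Cl| + 2) a tl tu.+1 _ _ _)).
- by rewrite !addr_ge0.
- by rewrite -natr1; have := normr_ge0 Cl; lra.
- by have := normr_ge0 Cu; lra.
rewrite !(probability_undecided n0 fu decr (hX n n0) (hx0 n)).
rewrite -EFinB -EFinD lee_fin [leRHS]splitr; apply: lerD.
  rewrite -[leRHS](step_cst n f _ (x0 n / n%:R)).
  by apply: step_le => // z gz; exact: upper_t.
rewrite -iter_step_compl; apply: lower_t => //.
have := close n nN0; rewrite ler_norml le_minority => /andP[h1 h2].
have dle : `|d * Num.sqrt n%:R| = `|d| * Num.sqrt n%:R.
  by rewrite normrM [`|Num.sqrt _|]gtr0_norm.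
have d1 := ler_norm (d * Num.sqrt n%:R); have d2 := ler_norm (- (d * Num.sqrt n%:R)).
rewrite normrN !dle in d2; rewrite dle in d1.
have E : (`|d| + 1) / Num.sqrt n%:R = (`|d| + 1) * Num.sqrt n%:R / n%:R.
  by apply/eqP; rewrite eqr_div ?(gt_eqF r0) ?(gt_eqF nR)// -mulrA -expr2 rr.
rewrite E; have -> : 2^-1 = n%:R / 2 / n%:R :> R by field; rewrite gt_eqF.
apply/andP; split.
  by rewrite -mulrBl ler_pM2r ?invr_gt0//; lra.
have -> : 1 - (n%:R / 2 / n%:R - (`|d| + 1) * Num.sqrt n%:R / n%:R) =
    (n%:R / 2 + (`|d| + 1) * Num.sqrt n%:R) / n%:R by field; rewrite gt_eqF.
by rewrite ler_pM2r ?invr_gt0//; lra.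
Qed.
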